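(* Let $v\in\mathcal{Q}_2$ be a unitary that normalizes the diagonal $\mathcal{D}_2$, i.e. $v\mathcal{D}_2v^*=\mathcal{D}_2$. Then $v$ can be uniquely written as $v=dP$, where $d$ is a unitary belonging to $\mathcal{D}_2$ and $P\in\mathcal{Q}_2$ is a unitary of the form $$P=\sum_{i=1}^N S_{\alpha_i}U^{k_i}S_{\beta_i}^*,$$ for some $N\in\mathbb{N}$ and triples $(\alpha_i,\beta_i,k_i)\in W_2\times W_2\times\mathbb{Z}$, with $\sum_{i=1}^N S_{\alpha_i}S_{\alpha_i}^*=\sum_{i=1}^N S_{\beta_i}S_{\beta_i}^*=1$.
   Context: The $2$-adic ring $C^*$-algebra $\mathcal{Q}_2$ is the universal $C^*$-algebra generated by a unitary $U$ and an isometry $S_2$ such that $S_2U=U^2S_2$ and $S_2S_2^*+US_2S_2^*U^*=1$. Put $S_1:=US_2$. Let $W_2:=\bigcup_{n\ge 0}\{1,2\}^n$ be the set of finite multi-indices; for $\alpha=(\alpha_1,\dots,\alpha_k)\in W_2$ put $S_\alpha:=S_{\alpha_1}\cdots S_{\alpha_k}$ (with $S_\emptyset=1$). The diagonal $\mathcal{D}_2$ is the (commutative) $C^*$-subalgebra of $\mathcal{Q}_2$ generated by the projections $S_\alpha S_\alpha^*$, $\alpha\in W_2$. *)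

(* Defs.v *)
From HB Require Import structures.
From mathcomp Require Import all_boot all_order all_algebra.
From mathcomp Require Import all_classical all_reals all_analysis.
From mathcomp Require Export complex.
Set Implicit Arguments.
Unset Strict Implicit.
Unset Printing Implicit Defensive.
Import Order.TTheory GRing.Theory Num.Theory.
Import numFieldNormedType.Exports.
Local Open Scope classical_set_scope.
Local Open Scope complex_scope.
Local Open Scope ring_scope.

(* Unital complex C*-algebras.  The norm is an operation of the mixin, and not
   the one of [normedModType R[i]]: Hierarchy-Builder refuses a common
   descendant of [GRing.PzSemiRing] and [Num.SemiNormedZmodule] next to
   [Num.NumDomain], so [algType] and [normedModType] cannot be joined.
   Nonnegativity of the norm follows from [cnormD] and [cnormZ].
   [algType] asks for [1 != 0], so the zero algebra is excluded. *)
HB.mixin Record isCStarAlgebra (R : realType) A & GRing.Algebra R[i] A := {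
  star : A -> A;
  starK : involutive star;
  starD : {morph star : x y / x + y};
  starZ : forall (c : R[i]) x, star (c *: x) = c^* *: star x;
  starM : forall x y, star (x * y) = star y * star x;
  cnorm : A -> R;
  cnorm0_eq0 : forall x, cnorm x = 0 -> x = 0;
  cnormD : forall x y, cnorm (x + y) <= cnorm x + cnorm y;
  cnormZ : forall (c : R[i]) x, (cnorm (c *: x))%:C = `|c| * (cnorm x)%:C;
  cnormM : forall x y, cnorm (x * y) <= cnorm x * cnorm y;
  cnorm_starM : forall x, cnorm (star x * x) = cnorm x ^+ 2;
  cnorm_complete : forall u : nat -> A,
    (forall e : R, 0 < e -> exists N : nat, forall m n : nat,
       (N <= m)%N -> (N <= n)%N -> cnorm (u m - u n) < e) ->
    exists l : A, cnorm (u n - l) @[n --> \oo] --> (0 : R)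
}.

#[short(type="cstarAlgType")]
HB.structure Definition CStarAlgebra (R : realType) :=
  {A of GRing.Algebra R[i] A & isCStarAlgebra R A}.

Section CStarAlgebra.
Variables (R : realType) (A : cstarAlgType R).

Definition unitary (u : A) : Prop := star u * u = 1 /\ u * star u = 1.

Definition isometry (s : A) : Prop := star s * s = 1.

Definition norm_closed (B : set A) : Prop :=
  forall (u : nat -> A) (l : A), (forall n, B (u n)) ->
    cnorm (u n - l) @[n --> \oo] --> (0 : R) -> B l.

Definition cstar_subalgebra (B : set A) : Prop :=
  [/\ B 0,
      (forall (c : R[i]) x y, B x -> B y -> B (c *: x + y)),
      (forall x y, B x -> B y -> B (x * y)),
      (forall x, B x -> B (star x)) &
      norm_closed B].

Definition cstar_generated (X : set A) : set A := smallest cstar_subalgebra X.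

End CStarAlgebra.

Section Q2.
Variables (R : realType) (A : cstarAlgType R) (U S2 : A).

Definition Q2_relations : Prop :=
  [/\ unitary U, isometry S2, S2 * U = U ^+ 2 * S2 &
      S2 * star S2 + U * S2 * star S2 * star U = 1].

(* The letters 1 and 2 are encoded by [true] and [false]. *)
Definition Sletter (i : bool) : A := if i then U * S2 else S2.

Definition Sword (a : seq bool) : A := \prod_(i <- a) Sletter i.

Definition Upow (k : int) : A :=
  match k with
  | Posz n => U ^+ n
  | Negz n => star U ^+ n.+1
  end.

Definition diag2 : set A :=
  cstar_generated [set Sword a * star (Sword a) | a in [set: seq bool]].

Definition word_partition_sum (P : A) : Prop :=
  exists (N : nat) (a b : 'I_N -> seq bool) (k : 'I_N -> int),
    [/\ P = \sum_(i < N) Sword (a i) * Upow (k i) * star (Sword (b i)),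
        \sum_(i < N) Sword (a i) * star (Sword (a i)) = 1 &
        \sum_(i < N) Sword (b i) * star (Sword (b i)) = 1].

End Q2.

(* [(A, U, S2)] is the universal C*-algebra of the relations [Q2_relations], a
   description that determines it up to isomorphism: the morphism [phi] is
   unique because [U] and [S2] generate [A] and *-morphisms are continuous. *)
Definition is_Q2 (R : realType) (A : cstarAlgType R) (U S2 : A) : Prop :=
  [/\ Q2_relations U S2,
      cstar_generated [set U; S2] = [set: A] &
      forall (B : cstarAlgType R) (u s : B), Q2_relations u s ->
        exists phi : {lrmorphism A -> B},
          [/\ forall x, phi (star x) = star (phi x), phi U = u & phi S2 = s]].

(* Main.v *)
(* The isometries [aff a n = U ^ a * S2 ^ n] multiply like the affine maps
   [x |-> 2 ^ n * x + a] of the 2-adic integers, and the diagonal is generated by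
   their range projections [cyl a n], the cylinders.  Finite combinations of the
   elements [aff a n * (aff b m)^*] are dense.

   Existence.  On a deep enough cylinder, [x = v * aff b m] is close to a finite
   combination of isometries [aff a n].  Any two distinct affine maps send some
   subcylinder of any given cylinder to disjoint sets.  On a cylinder where all
   the images are disjoint, normalization forces [x] to have the same action as
   exactly one of the maps, and this is the one whose coefficient is close to 1
   in absolute value, hence does not depend on the cylinder.  As every cylinder contains
   such a good one, [x] acts on the whole diagonal as a single affine map.  The
   sum [P] of these maps satisfies [v * p * v^* = P * p * P^*] for [p] in the
   diagonal, so [d = v * P^*] commutes with the diagonal.

   The diagonal is maximal abelian.  If [d] commutes with it and is close to a
   scalar plus a combination of nontrivial affine maps, then [d] is close to this
   scalar on the cylinders moved by all these maps.  What remains are the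
   cylinders around a fixed point, where the maps are powers of a single one,
   [g].  There an isometry [T], an average of [g ^ k * V * g ^ (K - k)], almost
   commutes with [g], and the range of [g ^ E * T] is a union of moved cylinders;
   this carries the estimate over to the fixed point.

   Uniqueness.  If [d * P = d' * P'], then [Q = P' * P^*] lies in the diagonal, maps
   every small cylinder by an affine map, and preserves all of them; so [Q = 1]. *)
Require Import Defs.
From HB Require Import structures.
From mathcomp Require Import all_boot all_order all_algebra.
From mathcomp Require Import all_classical all_reals all_analysis.
From mathcomp Require Import zify ring lra.
Set Implicit Arguments.
Unset Strict Implicit.
Unset Printing Implicit Defensive.
Import Order.TTheory GRing.Theory Num.Theory.
Import numFieldNormedType.Exports.
Local Open Scope classical_set_scope.
Local Open Scope ring_scope.

Local Notation isometry := Defs.isometry.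

(** * Norms, isometries and projections in a C*-algebra *)

Section CStarNorm.
Variables (R : realType) (A : cstarAlgType R).
Implicit Types (x y z u p q e f : A) (c : R[i]).

Definition nc (c : R[i]) : R := complex.Re `|c|.

Lemma ncE c : (nc c)%:C%C = `|c|.
Proof. by rewrite /nc complex.RRe_real // normr_real. Qed.

Lemma nc_ge0 c : 0 <= nc c.
Proof. by have := normr_ge0 c; rewrite -ncE lecE /= eqxx. Qed.

Lemma ncV c : nc c^-1 = (nc c)^-1.
Proof. by apply: complexI; rewrite fmorphV /= !ncE normfV. Qed.

Lemma nc_nat n : nc n%:R = n%:R.
Proof. by apply: complexI; rewrite ncE normr_nat rmorph_nat. Qed.

Lemma ncB1 c : 1 - nc c <= nc (1 - c).
Proof.
have: `|1 : R[i]| - `|c| <= `|1 - c| by rewrite lerB_dist.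
by rewrite -!ncE lecE /= => /andP[_]; rewrite /nc normr1.
Qed.

Lemma starI : injective (@star R A).
Proof. exact: inv_inj (@starK R A). Qed.

Lemma star0 : star 0 = 0 :> A.
Proof. by have := starZ 0 (0 : A); rewrite !scale0r rmorph0 scale0r. Qed.

Lemma star1 : star 1 = 1 :> A.
Proof. by have := starM (star 1) (1 : A); rewrite mulr1 starK mulr1 => <-. Qed.

Lemma starN x : star (- x) = - star x.
Proof. by apply/eqP; rewrite -addr_eq0 -starD addNr star0. Qed.

Lemma starB x y : star (x - y) = star x - star y.
Proof. by rewrite starD starN. Qed.

Lemma star_sum I (r : seq I) (P : pred I) (F : I -> A) :
  star (\sum_(i <- r | P i) F i) = \sum_(i <- r | P i) star (F i).
Proof. by apply: (big_morph _ (@starD R A)); exact: star0. Qed.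

Lemma starX x n : star (x ^+ n) = star x ^+ n.
Proof. by elim: n => [|n IH]; rewrite ?expr0 ?star1 // exprS starM IH exprSr. Qed.

Lemma cnormZr c x : cnorm (c *: x) = nc c * cnorm x.
Proof. by apply: complexI; rewrite cnormZ rmorphM /= ncE. Qed.

Lemma cnorm0 : cnorm (0 : A) = 0.
Proof. by rewrite -[0 in LHS](scale0r (0 : A)) cnormZr (_ : nc 0 = 0) ?mul0r // /nc normr0. Qed.

Lemma cnormN x : cnorm (- x) = cnorm x.
Proof. by rewrite -scaleN1r cnormZr /nc normrN normr1 mul1r. Qed.

Lemma cnorm_ge0 x : 0 <= cnorm x.
Proof.
have := cnormD x (- x); rewrite subrr cnorm0 cnormN -mulr2n.
by rewrite pmulrn_lge0.
Qed.

Lemma cnormB x y : cnorm (x - y) <= cnorm x + cnorm y.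
Proof. by rewrite -(cnormN y) cnormD. Qed.

Lemma cnormBC x y : cnorm (x - y) = cnorm (y - x).
Proof. by rewrite -cnormN opprB. Qed.

Lemma cnormBD z x y : cnorm (x - y) <= cnorm (x - z) + cnorm (z - y).
Proof. by rewrite -[x - y](subrKA z) cnormD. Qed.

Lemma cnorm_le_dist x y : cnorm x <= cnorm y + cnorm (x - y).
Proof. by rewrite -{1}[x](subrKC y) cnormD. Qed.

Lemma cnorm_sum I (r : seq I) (P : pred I) (F : I -> A) :
  cnorm (\sum_(i <- r | P i) F i) <= \sum_(i <- r | P i) cnorm (F i).
Proof.
elim/big_ind2: _ => [|x a y b xa yb|//]; first by rewrite cnorm0.
by apply: le_trans (cnormD _ _) _; apply: lerD.
Qed.

(** The C*-identity and submultiplicativity give |x|^2 <= |star x| |x|. Cancel |x|, then exchange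
    [x] and [star x]. *)
Lemma cnorm_star x : cnorm (star x) = cnorm x.
Proof.
wlog suff le : x / cnorm x <= cnorm (star x).
  by apply/eqP; rewrite eq_le le -{2}[x]starK le.
have [->|x0] := eqVneq x 0; first by rewrite star0.
have xp : 0 < cnorm x.
  rewrite lt_neqAle cnorm_ge0 andbT eq_sym.
  by apply: contra x0 => /eqP/cnorm0_eq0 ->.
by rewrite -(ler_pM2r xp) -expr2 -cnorm_starM cnormM.
Qed.

Lemma star_mul_eq0 x : star x * x = 0 -> x = 0.
Proof.
move=> h; apply: cnorm0_eq0; apply/eqP.
by rewrite -sqrf_eq0 -cnorm_starM h cnorm0.
Qed.

Lemma mul_star_eq0 x : x * star x = 0 -> x = 0.
Proof.
move=> h; rewrite -[x]starK (_ : star x = 0) ?star0 //.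
by apply: star_mul_eq0; rewrite starK.
Qed.

Definition projection p : Prop := star p = p /\ p * p = p.

Lemma sqr_eq_cnorm (a b : R) : 0 <= a -> 0 <= b -> a ^+ 2 = b ^+ 2 -> a = b.
Proof. by move=> a0 b0 /eqP; rewrite eqrXn2 // => /eqP. Qed.

Lemma cnorm_proj p : projection p -> p != 0 -> cnorm p = 1.
Proof.
move=> [sp pp] p0; have := cnorm_starM p; rewrite sp pp expr2 => h.
apply: (@mulIf _ (cnorm p)); last by rewrite mul1r.
by apply: contra p0 => /eqP/cnorm0_eq0 ->.
Qed.

Lemma projection1 : projection 1.
Proof. by split; rewrite ?star1 ?mulr1. Qed.

Lemma projectionC p : projection p -> projection (1 - p).
Proof.
move=> [sp pp]; split; first by rewrite starB star1 sp.
by rewrite mulrBr mulr1 mulrBl mul1r pp subrr subr0.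
Qed.

Lemma cnorm_proj_le1 p : projection p -> cnorm p <= 1.
Proof.
by move=> hp; have [->|/(cnorm_proj hp)->//] := eqVneq p 0; rewrite cnorm0 ler01.
Qed.

Lemma cnorm1 : cnorm (1 : A) = 1.
Proof. by rewrite cnorm_proj ?oner_neq0 //; exact: projection1. Qed.

Lemma cnorm_isomM e x : isometry e -> cnorm (e * x) = cnorm x.
Proof.
move=> he; apply: sqr_eq_cnorm; rewrite ?cnorm_ge0 // -!cnorm_starM.
by rewrite starM mulrA -(mulrA (star x)) he mulr1.
Qed.

Lemma cnorm_isom e : isometry e -> cnorm e = 1.
Proof. by move=> he; rewrite -[e]mulr1 cnorm_isomM // cnorm1. Qed.

Lemma isometryM e f : isometry e -> isometry f -> isometry (e * f).
Proof. by rewrite /isometry => he hf; rewrite starM mulrA -(mulrA (star f)) he mulr1. Qed.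

Lemma isometry1 : isometry (1 : A).
Proof. by rewrite /isometry star1 mulr1. Qed.

Lemma isometryX e n : isometry e -> isometry (e ^+ n).
Proof.
move=> he; elim: n => [|n IH]; rewrite ?expr0 ?exprS; first exact: isometry1.
exact: isometryM.
Qed.

Lemma cnormM_isom x e : isometry e -> cnorm (x * e) <= cnorm x.
Proof. by move=> he; rewrite -[leRHS]mulr1 -(cnorm_isom he) cnormM. Qed.

Lemma cnormM_starisom x e : isometry e -> cnorm (x * star e) = cnorm x.
Proof. by move=> he; rewrite -cnorm_star starM starK cnorm_isomM // cnorm_star. Qed.

Lemma cnorm_starisomM e x : isometry e -> cnorm (star e * x) <= cnorm x.
Proof.
move=> he; rewrite -cnorm_star starM starK.
by apply: le_trans (cnormM_isom _ he) _; rewrite cnorm_star.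
Qed.

Lemma cnormM_proj x p : projection p -> cnorm (x * p) <= cnorm x.
Proof.
move=> /cnorm_proj_le1 p1; apply: le_trans (cnormM _ _) _.
by rewrite ler_piMr // cnorm_ge0.
Qed.

Lemma cnorm_projM x p : projection p -> cnorm (p * x) <= cnorm x.
Proof.
move=> /cnorm_proj_le1 p1; apply: le_trans (cnormM _ _) _.
by rewrite ler_piMl // cnorm_ge0.
Qed.

Lemma projection_isom e : isometry e -> projection (e * star e).
Proof. by move=> he; split; rewrite ?starM ?starK // -mulrA (mulrA (star e)) he mul1r. Qed.

Lemma projection_conj e p : isometry e -> projection p -> projection (e * p * star e).
Proof.
move=> he [sp pp]; split; first by rewrite !starM starK sp mulrA.
by rewrite -!mulrA (mulrA (star e)) he mul1r (mulrA p) pp.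
Qed.

(** The C*-identity is iterated on self-adjoint powers; this takes the place of the spectral radius
    in [cnorm_block]. *)
Lemma cnorm_sa_expr x k : star x = x -> cnorm (x ^+ (2 ^ k)) = cnorm x ^+ (2 ^ k).
Proof.
move=> sx; elim: k => [|k IH]; first by rewrite expn0 !expr1.
have sxk : star (x ^+ (2 ^ k)) = x ^+ (2 ^ k) by rewrite starX sx.
by rewrite expnSr !exprM -IH -cnorm_starM sxk expr2.
Qed.

Lemma expr2_unbounded (a : R) (n : nat) : 1 < a -> exists k, n%:R < a ^+ (2 ^ k).
Proof.
move=> a1; have d0 : 0 < a - 1 by rewrite subr_gt0.
have [k hk] : exists k : nat, n%:R / (a - 1) < k%:R.
  exists (Num.bound (n%:R / (a - 1))); apply: archi_boundP.
  by rewrite divr_ge0 // ltW.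
exists k; rewrite ltr_pdivrMr // in hk; apply: lt_le_trans hk _.
have bern m : 1 + m%:R * (a - 1) <= a ^+ m.
  elim: m => [|m IH]; first by rewrite mul0r addr0 expr0.
  rewrite exprS -natr1; apply: le_trans (_ : a * (1 + m%:R * (a - 1)) <= _).
    have := mulr_ge0 (ler0n R m) (sqr_ge0 (a - 1)); nra.
  by rewrite ler_pM2l // (lt_trans ltr01).
apply: le_trans (_ : (2 ^ k)%:R * (a - 1) <= _).
  by rewrite ler_pM2r // ler_nat ltnW // ltn_expl.
by apply: le_trans (bern _); rewrite lerDr ler01.
Qed.

(* With [h = z^* z], the norm of [(h q) ^ (2 ^ k)] is the [2 ^ k]-th power of that
   of [h q], but at most the sum of [N] blocks of norm at most [t ^ (2 ^ (k + 1))]. *)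
Lemma cnorm_block (N : nat) (p : 'I_N -> A) z (t : R) : 0 < t ->
  (forall i, projection (p i)) -> (forall i j, i != j -> p i * p j = 0) ->
  (forall i, z * p i = p i * z) -> (forall i, cnorm (z * p i) <= t) ->
  cnorm (z * \sum_i p i) <= t.
Proof.
move=> t0 hp ho zc zp.
pose h := star z * z; pose q := \sum_i p i.
have pp i : p i * p i = p i by case: (hp i).
have sp i : star (p i) = p i by case: (hp i).
have hc i : h * p i = p i * h.
  by rewrite /h -mulrA zc mulrA -{1}sp -starM -zc starM sp mulrA.
have hn i : cnorm (h * p i) <= t ^+ 2.
  rewrite (_ : h * p i = star (z * p i) * (z * p i)).
    by rewrite cnorm_starM lerXn2r ?nnegrE ?cnorm_ge0 // ltW.
  by rewrite starM sp mulrA -(mulrA (p i)) -/h -hc -mulrA pp.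
have hpX i n : (h * p i) ^+ n.+1 = h ^+ n.+1 * p i.
  elim: n => [|n IH]; first by rewrite !expr1.
  have cX : p i * h ^+ n.+1 = h ^+ n.+1 * p i.
    by have := @commrX _ (p i) h n.+1 (esym (hc i)).
  by rewrite exprS IH [in RHS]exprS -!mulrA (mulrA (p i)) cX -(mulrA _ (p i)) pp.
have hqX n : (h * q) ^+ n.+1 = \sum_i (h * p i) ^+ n.+1.
  have -> : h * q = \sum_i h * p i by rewrite mulr_sumr.
  elim: n => [|n IH]; first by rewrite expr1; apply: eq_bigr => i _; rewrite expr1.
  rewrite exprS IH mulr_suml; apply: eq_bigr => i _.
  rewrite mulr_sumr (bigD1 i) //= big1 ?addr0 -?exprS // => j ji.
  rewrite exprS mulrA (_ : h * p i * (h * p j) = 0) ?mul0r //.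
  by rewrite -mulrA (mulrA (p i)) -hc -(mulrA h) ho 1?eq_sym // !mulr0.
have sq : star q = q by rewrite star_sum; apply: eq_bigr => i _.
have qq : q * q = q.
  rewrite {1}/q mulr_suml; apply: eq_bigr => i _; rewrite mulr_sumr (bigD1 i) //=.
  by rewrite pp big1 ?addr0 // => j; rewrite eq_sym => /ho.
have hq : h * q = q * h by rewrite mulr_sumr mulr_suml; apply: eq_bigr => i _.
have zq : cnorm (z * q) ^+ 2 = cnorm (h * q).
  by rewrite -cnorm_starM starM sq mulrA -(mulrA q) -/h -hq -mulrA qq.
have shq : star (h * q) = h * q by rewrite starM sq starM starK -/h hq.
rewrite leNgt; apply/negP => lt_t.
(* Were the bound false, this ratio would exceed 1, and its power of some exponent [2 ^ k] would
   exceed the number [N] of blocks. *)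
have r1 : 1 < cnorm (h * q) / t ^+ 2.
  by rewrite ltr_pdivlMr ?exprn_gt0 // mul1r -zq ltrXn2r ?nnegrE ?cnorm_ge0 // ltW.
have [k] := expr2_unbounded N r1; apply/negP; rewrite -leNgt.
rewrite expr_div_n ler_pdivrMr ?exprn_gt0 ?exprn_gt0 // -cnorm_sa_expr //.
have -> : (2 ^ k)%N = (2 ^ k).-1.+1 by rewrite prednK // expn_gt0.
rewrite hqX; apply: le_trans (cnorm_sum _ _ _) _.
rewrite -[N in N%:R]card_ord -sum1_card natr_sum mulr_suml.
apply: ler_sum => i _; rewrite mul1r prednK ?expn_gt0 // cnorm_sa_expr.
  by rewrite lerXn2r ?nnegrE ?cnorm_ge0 // exprn_ge0 // ltW.
by rewrite starM sp starM starK -/h hc.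
Qed.

End CStarNorm.

(** * Generated C*-subalgebras *)

Section Subalgebras.
Variables (R : realType) (A : cstarAlgType R).
Implicit Types (x y z l : A) (B X G : set A) (c : R[i]).

Definition cclosure B : set A :=
  [set l | forall t : R, 0 < t -> exists y, B y /\ cnorm (y - l) < t].

Lemma norm_closedP B : norm_closed B <-> (cclosure B `<=` B).
Proof.
split=> [hB l hl|hB u l Bu ul].
  have hn (n : nat) : exists y, B y /\ cnorm (y - l) < n.+1%:R^-1.
    by apply: hl; rewrite invr_gt0.
  have /choice[u hu] := hn; apply: (hB u) => [n|]; first by case: (hu n).
  apply/cvgrPdist_lt => t t0; near=> n.
  rewrite sub0r normrN ger0_norm ?cnorm_ge0 //.
  apply: lt_trans (proj2 (hu n)) _.
  by near: n; exact: (near_infty_natSinv_lt (PosNum t0)).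
apply: hB => t t0; move/cvgrPdist_lt: ul => /(_ t t0)[N _ /(_ N)].
rewrite /= leqnn sub0r normrN ger0_norm ?cnorm_ge0 // => /(_ isT) h.
by exists (u N).
Unshelve. all: by end_near.
Qed.

Lemma cclosure_sub B x : B x -> cclosure B x.
Proof. by move=> Bx t t0; exists x; rewrite subrr cnorm0. Qed.

Lemma cclosureW B x : (forall t : R, 0 < t -> exists y, B y /\ cnorm (y - x) <= t) ->
  cclosure B x.
Proof.
move=> h t t0; have [|y [By yx]] := h (t / 2); first by rewrite divr_gt0.
by exists y; split => //; apply: le_lt_trans yx _; rewrite ltr_pdivrMr // ltr_pMr // ltr1n.
Qed.

Lemma cclosure_idem B : cclosure (cclosure B) `<=` cclosure B.
Proof.
move=> l hl t t0; have t2 : 0 < t / 2 by rewrite divr_gt0.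
have [y [hy yl]] := hl _ t2; have [z [Bz zy]] := hy _ t2.
exists z; split=> //; apply: le_lt_trans (cnormBD y _ _) _.
by rewrite [t]splitr ltrD.
Qed.

Lemma cclosure_subalgebra B : B 0 ->
  (forall c x y, B x -> B y -> B (c *: x + y)) ->
  (forall x y, B x -> B y -> B (x * y)) ->
  (forall x, B x -> B (star x)) -> cstar_subalgebra (cclosure B).
Proof.
move=> B0 Blin BM BS; split.
- exact: cclosure_sub.
- move=> c x y hx hy; apply: cclosureW => t t0.
  have c1 : 0 < nc c + 1 by rewrite ltr_wpDl ?nc_ge0.
  have [|x' [Bx' xx']] := hx (t / 2 / (nc c + 1)); first by rewrite !divr_gt0.
  have [|y' [By' yy']] := hy (t / 2); first by rewrite divr_gt0.
  exists (c *: x' + y'); split; first exact: Blin.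
  rewrite opprD addrACA -scalerBr; apply: le_trans (cnormD _ _) _.
  rewrite [leRHS]splitr; apply: lerD; last exact: ltW.
  rewrite cnormZr; apply: le_trans (_ : (nc c + 1) * cnorm (x' - x) <= _).
    by rewrite ler_wpM2r ?cnorm_ge0 // lerDl ler01.
  by rewrite mulrC -ler_pdivlMr // ltW.
- move=> x y hx hy; apply: cclosureW => t t0.
  pose a := cnorm x + 1; have a0 : 0 < a by rewrite ltr_wpDl ?cnorm_ge0.
  have [|y' [By' yy']] := hy (t / 2 / a); first by rewrite !divr_gt0.
  (* The approximation of [x] is chosen last, because its tolerance depends on the norm of [y']. *)
  pose b := cnorm y' + 1; have b0 : 0 < b by rewrite ltr_wpDl ?cnorm_ge0.
  have [|x' [Bx' xx']] := hx (t / 2 / b); first by rewrite !divr_gt0.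
  exists (x' * y'); split; first exact: BM.
  have -> : x' * y' - x * y = (x' - x) * y' + x * (y' - y).
    by rewrite mulrBl mulrBr addrA subrK.
  apply: le_trans (cnormD _ _) _; rewrite [leRHS]splitr; apply: lerD.
    apply: le_trans (cnormM _ _) _.
    apply: le_trans (_ : cnorm (x' - x) * b <= _).
      by rewrite ler_wpM2l ?cnorm_ge0 // lerDl ler01.
    by rewrite -ler_pdivlMr // ltW.
  apply: le_trans (cnormM _ _) _; apply: le_trans (_ : a * cnorm (y' - y) <= _).
    by rewrite ler_wpM2r ?cnorm_ge0 // lerDl ler01.
  by rewrite mulrC -ler_pdivlMr // ltW.
- move=> x hx t /hx[x' [Bx' xx']]; exists (star x'); split; first exact: BS.
  by rewrite -starB cnorm_star.
- by apply/norm_closedP; exact: cclosure_idem.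
Qed.

Lemma cstar_generated_sub X B :
  cstar_subalgebra B -> X `<=` B -> cstar_generated X `<=` B.
Proof. by move=> hB XB; apply: smallest_sub. Qed.

Lemma sub_cstar_generated X : X `<=` cstar_generated X.
Proof. exact: sub_smallest. Qed.

Lemma cstar_generated_subalgebra X : cstar_subalgebra (cstar_generated X).
Proof.
split.
- by move=> B [[]].
- move=> c x y hx hy B hB; have [[_ h _ _ _] _] := hB.
  by apply: h; [exact: hx|exact: hy].
- move=> x y hx hy B hB; have [[_ _ h _ _] _] := hB.
  by apply: h; [exact: hx|exact: hy].
- by move=> x hx B hB; have [[_ _ _ h _] _] := hB; apply: h; exact: hx.
- move=> u l hu ul B hB; have [[_ _ _ _ h] _] := hB.
  by apply: (h u) => // n; exact: hu.
Qed.

Definition cspan G : set A := [set x | exists s : seq (R[i] * A),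
  (forall i, i \in s -> G i.2) /\ x = \sum_(i <- s) i.1 *: i.2].

Lemma cspan0 G : cspan G 0.
Proof. by exists [::]; rewrite big_nil. Qed.

Lemma cspan_sub G x : G x -> cspan G x.
Proof.
move=> Gx; exists [:: (1, x)]; rewrite big_seq1 scale1r; split=> // i.
by rewrite inE => /eqP ->.
Qed.

Lemma cspanD G x y : cspan G x -> cspan G y -> cspan G (x + y).
Proof.
move=> [s [hs ->]] [s' [hs' ->]]; exists (s ++ s'); rewrite big_cat; split=> // i.
by rewrite mem_cat => /orP[/hs|/hs'].
Qed.

Lemma cspanZ G c x : cspan G x -> cspan G (c *: x).
Proof.
move=> [s [hs ->]]; exists [seq (c * i.1, i.2) | i <- s]; split.
  by move=> i /mapP[j /hs js ->].
by rewrite big_map scaler_sumr; apply: eq_bigr => i _; rewrite scalerA.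
Qed.

Lemma cspan_ind G (P : A -> Prop) : P 0 ->
  (forall c x y, G x -> P y -> P (c *: x + y)) -> forall x, cspan G x -> P x.
Proof.
move=> P0 PD _ [s [hs ->]]; elim: s hs => [|i s IH] hs; first by rewrite big_nil.
rewrite big_cons; apply: PD; first by apply: hs; rewrite mem_head.
by apply: IH => j js; apply: hs; rewrite inE js orbT.
Qed.

Lemma cspan_subalgebra G : (forall x y, G x -> G y -> cspan G (x * y)) ->
  (forall x, G x -> G (star x)) -> cstar_subalgebra (cclosure (cspan G)).
Proof.
move=> GM GS; apply: cclosure_subalgebra.
- exact: cspan0.
- by move=> c x y /(cspanZ c); exact: cspanD.
- move=> x y hx hy; elim/cspan_ind: hx => [|c x' z Gx' IH].
    by rewrite mul0r; exact: cspan0.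
  rewrite mulrDl -scalerAl; apply: cspanD IH; apply: cspanZ.
  elim/cspan_ind: hy => [|c' y' z' Gy' IH']; first by rewrite mulr0; exact: cspan0.
  by rewrite mulrDr -scalerAr; apply: cspanD IH'; apply: cspanZ; exact: GM.
- move=> x; elim/cspan_ind => [|c y z Gy IH]; first by rewrite star0; exact: cspan0.
  by rewrite starD starZ; apply: cspanD IH; apply: cspanZ; apply: cspan_sub; exact: GS.
Qed.

End Subalgebras.

(** * The affine isometries and the diagonal *)

(* [aff a n] acts as the affine map [x |-> 2 ^ n * x + a] of the 2-adic
   integers, and [cyl a n] as the indicator function of its image. *)
HB.lock Definition aff (R : realType) (A : cstarAlgType R) (U S : A) (a : int) (n : nat) : A :=
  Upow U a * S ^+ n.
HB.lock Definition cyl (R : realType) (A : cstarAlgType R) (U S : A) (a : int) (n : nat) : A :=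
  aff U S a n * star (aff U S a n).

Section AffineIsometries.
Variables (R : realType) (A : cstarAlgType R) (U S : A).
Hypothesis hQ : Q2_relations U S.

Local Notation u := (Upow U).

Lemma unitU : star U * U = 1. Proof. by case: hQ => [[]]. Qed.
Lemma unitU' : U * star U = 1. Proof. by case: hQ => [[]]. Qed.
Lemma isomS : star S * S = 1. Proof. by case: hQ. Qed.
Lemma SU : S * U = U ^+ 2 * S. Proof. by case: hQ. Qed.

Lemma Upow1D k : u (1 + k) = U * u k.
Proof.
case: k => [n|[|n]]; first by rewrite -PoszD add1n /= exprS.
  by rewrite /= expr1 unitU'.
rewrite (_ : 1 + Negz n.+1 = Negz n); last by lia.
by rewrite /= [in RHS]exprS mulrA unitU' mul1r.
Qed.

Lemma UpowB1 k : u (k - 1) = star U * u k.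
Proof. by rewrite -[k in RHS](subrKC 1) addrC Upow1D mulrA unitU mul1r addrC. Qed.

Lemma int_ind1 (P : int -> Prop) : P 0 -> (forall k, P k -> P (1 + k)) ->
  (forall k, P k -> P (k - 1)) -> forall k, P k.
Proof.
move=> P0 Pp Pm [n|n].
  by elim: n => [//|n /Pp]; rewrite -PoszD add1n.
elim: n => [|n IH]; first exact: (Pm 0 P0).
by rewrite (_ : Negz n.+1 = Negz n - 1); [exact: Pm|lia].
Qed.

Lemma UpowD j k : u (j + k) = u j * u k.
Proof.
elim/int_ind1: j => [|j IH|j IH]; first by rewrite add0r /= expr0 mul1r.
  by rewrite -addrA !Upow1D IH mulrA.
by rewrite addrAC !UpowB1 IH mulrA.
Qed.

Lemma Upow0 : u 0 = 1. Proof. exact: expr0. Qed.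
Lemma Upow1 : u 1 = U. Proof. exact: expr1. Qed.

Lemma Upow_unit k : unitary (u k).
Proof.
elim/int_ind1: k => [|k [h1 h2]|k [h1 h2]].
- by rewrite /unitary Upow0 star1 mulr1.
- rewrite Upow1D /unitary starM; split.
    by rewrite mulrA -(mulrA _ _ U) unitU mulr1.
  by rewrite mulrA -(mulrA U) h2 mulr1 unitU'.
- rewrite UpowB1 /unitary starM starK; split.
    by rewrite mulrA -(mulrA _ U) unitU' mulr1.
  by rewrite mulrA -(mulrA (star U)) h2 mulr1 unitU.
Qed.

Lemma UpowN k : u (- k) = star (u k).
Proof.
have [h1 h2] := Upow_unit k.
by rewrite -[LHS]mul1r -h1 -mulrA -UpowD subrr Upow0 mulr1.
Qed.

Lemma SUpow k : S * u k = u (2 * k) * S.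
Proof.
elim/int_ind1: k => [|k IH|k IH]; first by rewrite mulr0 Upow0 mulr1 mul1r.
  rewrite Upow1D mulrA SU -mulrA IH mulrA (_ : 2 * (1 + k) = 1 + (1 + 2 * k)); last by lia.
  by rewrite !Upow1D expr2 !mulrA.
rewrite UpowB1 (_ : 2 * (k - 1) = 2 * k - 1 - 1); last by lia.
rewrite !UpowB1 -!mulrA -IH.
(* Insert [star U * star U * U ^+ 2 = 1], so that the relation [SU] applies and the adjoints end up
   on the left. *)
have -> : S * (star U * u k) = star U * star U * (U ^+ 2 * S) * star U * u k.
  by rewrite expr2 !mulrA -(mulrA (star U) _ U) unitU mulr1 unitU mul1r.
by rewrite -SU -!mulrA (mulrA U) unitU' mul1r.
Qed.

Local Notation aff := (aff U S).
Local Notation cyl := (cyl U S).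

Lemma affE a n : aff a n = u a * S ^+ n. Proof. by rewrite aff.unlock. Qed.
Lemma cylE a n : cyl a n = aff a n * star (aff a n). Proof. by rewrite cyl.unlock. Qed.

(** The power of [U] in the second factor moves left through [S ^+ n], its exponent doubling at each
    [S]. *)
Lemma affM a n b m : aff a n * aff b m = aff (a + 2 ^+ n * b) (n + m).
Proof.
rewrite !affE UpowD exprD -!mulrA; congr (_ * _); rewrite !mulrA; congr (_ * _).
elim: n => [|n IH]; first by rewrite !expr0 !mul1r mulr1.
by rewrite exprS -mulrA IH mulrA SUpow exprS -!mulrA.
Qed.

Lemma aff_extend a n j : aff a (n + j) = aff a n * aff 0 j.
Proof. by rewrite affM mulr0 addr0. Qed.

Lemma aff00 : aff 0 0 = 1.
Proof. by rewrite !affE Upow0 expr0 mulr1. Qed.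

Lemma aff_isom a n : isometry (aff a n).
Proof.
rewrite affE; apply: isometryM; last by apply: isometryX; exact: isomS.
by case: (Upow_unit a).
Qed.

Lemma affK a n x : star (aff a n) * (aff a n * x) = x.
Proof. by rewrite mulrA aff_isom mul1r. Qed.

Lemma cyl_proj a n : projection (cyl a n).
Proof. rewrite cylE; exact: projection_isom (aff_isom a n). Qed.

Lemma star_cyl a n : star (cyl a n) = cyl a n.
Proof. by case: (cyl_proj a n). Qed.

Lemma cyl_idem a n : cyl a n * cyl a n = cyl a n.
Proof. by case: (cyl_proj a n). Qed.

Lemma cyl_aff a n : cyl a n * aff a n = aff a n.
Proof. by rewrite cylE -mulrA aff_isom mulr1. Qed.

Lemma cnorm_aff a n : cnorm (aff a n) = 1.
Proof. by rewrite cnorm_isom //; exact: aff_isom. Qed.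

Lemma aff_neq0 a n : aff a n != 0.
Proof.
apply/eqP => h; have := cnorm_aff a n.
by rewrite h cnorm0 => /eqP; rewrite eq_sym oner_eq0.
Qed.

Lemma cyl_neq0 a n : cyl a n != 0.
Proof.
apply/eqP => h; have := cyl_aff a n; rewrite h mul0r => /esym/eqP.
by rewrite (negPf (aff_neq0 _ _)).
Qed.

Lemma cyl_sum1 : cyl 0 1 + cyl 1 1 = 1.
Proof.
have [_ _ _ <-] := hQ.
by rewrite !cylE !affE Upow0 Upow1 expr1 mul1r starM !mulrA.
Qed.

(** Compressing [cyl_sum1] by [S] leaves 1 + x x^* = 1 with x = [star S * U * S]. *)
Lemma star_S_U_S : star S * U * S = 0.
Proof.
apply: mul_star_eq0; have := congr1 (fun x => star S * x * S) cyl_sum1.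
rewrite mulr1 isomS mulrDr mulrDl !cylE !affE Upow0 Upow1 expr1 mul1r.
have -> : star S * (S * star S) * S = 1 by rewrite mulrA isomS mul1r isomS.
move/eqP; rewrite -subr_eq0 addrAC subrr add0r => /eqP h.
by rewrite -[RHS]h !starM starK !mulrA.
Qed.

Lemma star_S_Upow_S k : star S * u k * S = if (2 %| k)%Z then u (k %/ 2)%Z else 0.
Proof.
have [|] := boolP (2 %| k)%Z.
  move=> /dvdzP[q ->]; rewrite mulzK // mulrC -mulrA -SUpow mulrA isomS mul1r //.
move=> h; have -> : k = 1 + 2 * (k %/ 2)%Z by lia.
by rewrite Upow1D mulrA -mulrA -SUpow mulrA star_S_U_S mul0r.
Qed.

Lemma aff_dvd a n b m : (n <= m)%N -> (2 ^+ n %| b - a)%Z ->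
  star (aff a n) * aff b m = aff ((b - a) %/ 2 ^+ n)%Z (m - n).
Proof.
move=> nm /dvdzP[q hq]; rewrite hq mulzK ?expf_neq0 //.
have -> : b = a + 2 ^+ n * q by rewrite mulrC -hq subrKC.
by rewrite -{1}(subnKC nm) -affM affK.
Qed.

(** The factors [S] are peeled off one binary digit of [b - a] at a time: an even exponent of [U] is
    halved, and the first odd one gives 0. *)
Lemma aff_ndvd a n b m : (n <= m)%N -> ~~ (2 ^+ n %| b - a)%Z ->
  star (aff a n) * aff b m = 0.
Proof.
move=> /subnKC <-; rewrite !affE starM -UpowN exprD.
suff H c : ~~ (2 ^+ n %| c)%Z -> star (S ^+ n) * u c * S ^+ n = 0.
  move=> /H {H}; rewrite addrC UpowD => h.
  by rewrite !mulrA in h *; rewrite h mul0r.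
elim: n c => [|n IH] c; first by rewrite expr0 dvd1z.
have [|c2 _] := boolP (2 %| c)%Z; last first.
  rewrite exprS starM; have := star_S_Upow_S c; rewrite (negPf c2) => h.
  have -> : star (S ^+ n) * star S * u c * (S * S ^+ n) =
            star (S ^+ n) * (star S * u c * S) * S ^+ n by rewrite !mulrA.
  by rewrite h mulr0 mul0r.
move=> c2; have := star_S_Upow_S c; rewrite c2; case/dvdzP: c2 => q ->.
rewrite exprSr dvdz_mul2r // => h /IH {}IH.
rewrite exprS starM.
have -> : star (S ^+ n) * star S * u (q * 2) * (S * S ^+ n) =
            star (S ^+ n) * (star S * u (q * 2) * S) * S ^+ n by rewrite !mulrA.
by rewrite h mulzK.
Qed.

End AffineIsometries.

Lemma pow2Z n : (2 ^ n)%N = 2 ^+ n :> int.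
Proof. by elim: n => [//|n IH]; rewrite expnS PoszM IH exprS. Qed.

(** * Cylinders, words, and the diagonal they generate *)

Section Diagonal.
Variables (R : realType) (A : cstarAlgType R) (U S : A).
Hypothesis hQ : Q2_relations U S.

Local Notation u := (Upow U).
Local Notation aff := (aff U S).
Local Notation cyl := (cyl U S).
Local Notation D := (diag2 U S).

Lemma aff_dvdE a b n : (2 ^+ n %| b - a)%Z -> exists k, aff b n = aff a n * u k.
Proof.
move=> /dvdzP[q hq]; exists q; rewrite -[u q]mulr1 -(expr0 S) -affE affM //.
by rewrite addn0 mulrC -hq subrKC.
Qed.

(** The two isometries differ by a unitary factor on the right, which cancels in the range
    projection. *)
Lemma cyl_dvdE a b n : (2 ^+ n %| b - a)%Z -> cyl b n = cyl a n.
Proof.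
move=> /aff_dvdE[k hk]; rewrite !cylE hk starM mulrA -(mulrA _ (u k)).
by have [_ ->] := Upow_unit hQ k; rewrite mulr1.
Qed.

Lemma cyl_affM_dvd a n b m : (n <= m)%N -> (2 ^+ n %| b - a)%Z ->
  cyl a n * aff b m = aff b m.
Proof.
move=> nm ab; rewrite cylE -mulrA aff_dvd // affM // subnKC // mulrC divzK //.
by rewrite subrKC.
Qed.

Lemma cyl_affM_ndvd a n b m : (n <= m)%N -> ~~ (2 ^+ n %| b - a)%Z ->
  cyl a n * aff b m = 0.
Proof. by move=> nm ab; rewrite cylE -mulrA aff_ndvd // mulr0. Qed.

Lemma cylM_dvd a n b m : (n <= m)%N -> (2 ^+ n %| b - a)%Z ->
  cyl a n * cyl b m = cyl b m.
Proof. by move=> nm ab; rewrite [cyl b m]cylE mulrA cyl_affM_dvd. Qed.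

Lemma cylM_ndvd a n b m : (n <= m)%N -> ~~ (2 ^+ n %| b - a)%Z ->
  cyl a n * cyl b m = 0.
Proof. by move=> nm ab; rewrite [cyl b m]cylE mulrA cyl_affM_ndvd // mul0r. Qed.

(** Two cylinders are nested or disjoint, so their product is self-adjoint. *)
Lemma cylC a n b m : cyl a n * cyl b m = cyl b m * cyl a n.
Proof.
wlog nm : a n b m / (n <= m)%N.
  by move=> H; case/orP: (leq_total n m) => /H ->.
suff: star (cyl a n * cyl b m) = cyl a n * cyl b m by rewrite starM !star_cyl.
have [h|h] := boolP (2 ^+ n %| b - a)%Z; first by rewrite cylM_dvd // star_cyl.
by rewrite cylM_ndvd // star0.
Qed.

Lemma cyl00 : cyl 0 0 = 1.
Proof. by rewrite !cylE aff00 star1 mulr1. Qed.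

Lemma aff_cyl_aff a n b m : aff a n * cyl b m * star (aff a n) = cyl (a + 2 ^+ n * b) (n + m).
Proof. by rewrite !cylE -(affM hQ) starM !mulrA. Qed.

(** The cylinder of residue [i] at level [n] splits into those of residues [i] and [2 ^ n + i] at
    the next level. *)
Lemma cyl_sum n : \sum_(i < 2 ^ n) cyl i%:Z n = 1.
Proof.
elim: n => [|n IH]; first by rewrite big_ord1 cyl00.
have E : (2 ^ n.+1 = 2 ^ n + 2 ^ n)%N by rewrite expnS mul2n addnn.
rewrite (eq_bigr (fun i : 'I_(2 ^ n.+1) => (fun j : nat => cyl j%:Z n.+1) i)) //.
rewrite -(big_mkord xpredT (fun j : nat => cyl j%:Z n.+1)) E big_mkord big_split_ord /=.
rewrite -big_split /= -[RHS]IH; apply: eq_bigr => i _.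
have := aff_cyl_aff i n 0 1; have := aff_cyl_aff i n 1 1.
rewrite mulr0 mulr1 addr0 addn1.
have -> : (i%:Z + 2 ^+ n = (2 ^ n + i)%N%:Z) by rewrite PoszD pow2Z addrC.
by move=> <- <-; rewrite -mulrDl -mulrDr (cyl_sum1 hQ) mulr1 -cylE.
Qed.

Lemma cyl_ord_orth n (i j : 'I_(2 ^ n)) : i != j -> cyl i%:Z n * cyl j%:Z n = 0.
Proof.
move=> ij; apply: cylM_ndvd => //; apply: contra ij => h.
have : (j%:Z = i%:Z %[mod (2 ^ n)%N%:Z])%Z.
  by apply/eqP; rewrite eqz_mod_dvd pow2Z.
by rewrite !modz_nat !modn_small ?ltn_ord // => -[ji]; rewrite eq_sym; apply/eqP/val_inj.
Qed.

(** The factor of larger level absorbs the other one or is orthogonal to it. Products of isometries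
    and adjoints thus reduce to the form [aff a n * star (aff b m)]. *)
Lemma star_aff_aff a n b m : [\/ star (aff a n) * aff b m = 0,
  exists c k, star (aff a n) * aff b m = aff c k |
  exists c k, star (aff a n) * aff b m = star (aff c k)].
Proof.
have H a' n' b' m' : (n' <= m')%N -> star (aff a' n') * aff b' m' = 0 \/
    exists c k, star (aff a' n') * aff b' m' = aff c k.
  move=> nm; have [ab|ab] := boolP (2 ^+ n' %| b' - a')%Z.
    by right; exists ((b' - a') %/ 2 ^+ n')%Z, (m' - n')%N; rewrite aff_dvd.
  by left; rewrite aff_ndvd.
have [/(H a n b m)[h|h]|/ltnW/(H b m a n)[h|[c [k h]]]] := leqP n m.
- exact: Or31.
- exact: Or32.
- by apply: Or31; apply: starI; rewrite star0 -h starM starK.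
- by apply: Or33; exists c, k; rewrite -h starM starK.
Qed.

Lemma Sword_aff a : exists b, Sword U S a = aff b (size a).
Proof.
elim: a => [|i a [b hb]]; first by exists 0; rewrite /Sword big_nil aff00.
rewrite /Sword big_cons -/(Sword U S a) hb.
have -> : Sletter U S i = aff i%:Z 1.
  by case: i; rewrite affE /Sletter expr1 ?Upow0 ?Upow1 ?mul1r.
by rewrite affM //; eexists.
Qed.

(** The word lists the [n] lowest binary digits of [a], lowest first, and the remaining quotient is
    the exponent of [U]. *)
Lemma aff_Sword n a : exists s k, aff a n = Sword U S s * u k.
Proof.
elim: n a => [|n IH] a.
  by exists [::], a; rewrite /Sword big_nil mul1r affE expr0 mulr1.
have [s [k h]] := IH (a %/ 2)%Z; exists ((a %% 2 != 0)%Z :: s), k.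
rewrite /Sword big_cons -/(Sword U S s) -mulrA -h.
have -> : Sletter U S (a %% 2 != 0)%Z = aff (a %% 2)%Z 1.
  have [->|->] : (a %% 2 = 0)%Z \/ (a %% 2 = 1)%Z by lia.
    by rewrite affE /Sletter expr1 Upow0 mul1r.
  by rewrite affE /Sletter expr1 Upow1.
rewrite affM //; congr (aff _ _); rewrite expr1; lia.
Qed.

Lemma cyl_Sword a n : exists s, cyl a n = Sword U S s * star (Sword U S s).
Proof.
have [s [k h]] := aff_Sword n a; exists s.
rewrite !cylE h starM mulrA -(mulrA _ (u k)).
by have [_ ->] := Upow_unit hQ k; rewrite mulr1.
Qed.

Lemma diag_cyl a n : D (cyl a n).
Proof. by have [s ->] := cyl_Sword a n; apply: sub_cstar_generated; exists s. Qed.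

Lemma diag_sub B : cstar_subalgebra B -> (forall a n, B (cyl a n)) -> D `<=` B.
Proof.
move=> hB Bc; apply: cstar_generated_sub => // _ [s _ <-].
by have [b ->] := Sword_aff s; rewrite -cylE; exact: Bc.
Qed.

Lemma diag_subalgebra : cstar_subalgebra D.
Proof. exact: cstar_generated_subalgebra. Qed.

Lemma diag1 : D 1.
Proof. by rewrite -cyl00; exact: diag_cyl. Qed.

Lemma diag0 : D 0.
Proof. by case: diag_subalgebra. Qed.

Lemma diagM x y : D x -> D y -> D (x * y).
Proof. by case: diag_subalgebra => _ _ h _ _; exact: h. Qed.

Lemma diag_star x : D x -> D (star x).
Proof. by case: diag_subalgebra => _ _ _ h _; exact: h. Qed.

Lemma diag_scaleD c x y : D x -> D y -> D (c *: x + y).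
Proof. by case: diag_subalgebra => _ h _ _ _; exact: h. Qed.

Lemma diagZ c x : D x -> D (c *: x).
Proof. by move=> Dx; rewrite -[_ *: _]addr0; apply: diag_scaleD => //; exact: diag0. Qed.
Lemma diagD x y : D x -> D y -> D (x + y).
Proof. by move=> Dx Dy; rewrite -[x]scale1r; apply: diag_scaleD. Qed.
Lemma diagB x y : D x -> D y -> D (x - y).
Proof. by move=> Dx Dy; rewrite addrC -scaleN1r; apply: diag_scaleD. Qed.
Lemma diag_closed x : cclosure D x -> D x.
Proof. by case: diag_subalgebra => _ _ _ _ /norm_closedP; apply. Qed.

Lemma comm_subalgebra (X : set A) : (forall x, X x -> X (star x)) ->
  cstar_subalgebra [set y | forall x, X x -> y * x = x * y].
Proof.
move=> sX; split.
- by move=> x _; rewrite mul0r mulr0.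
- move=> c x y hx hy z Xz.
  by rewrite mulrDl mulrDr -scalerAl -scalerAr hx // hy.
- by move=> x y hx hy z Xz; rewrite -mulrA hy // mulrA hx // mulrA.
- by move=> x hx z Xz; apply: starI; rewrite !starM starK hx //; exact: sX.
- apply/norm_closedP => y hy x Xx; apply/eqP; rewrite -subr_eq0.
  have [//|nz] := eqVneq; have nz' : 0 < cnorm (y * x - x * y).
    rewrite lt_neqAle cnorm_ge0 andbT eq_sym; apply: contra nz => /eqP.
    by move=> /cnorm0_eq0 ->.
  pose a := cnorm x + 1; have a0 : 0 < a by rewrite ltr_wpDl ?cnorm_ge0.
  (* With this tolerance, the bound 2 a |z - y| on the norm of the commutator is smaller than that
     norm itself. *)
  have [|z [hz zy]] := hy (cnorm (y * x - x * y) / a / 2%:R).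
    by rewrite !divr_gt0.
  have : cnorm (y * x - x * y) <= cnorm (z - y) * a + a * cnorm (z - y).
    have -> : y * x - x * y = x * (z - y) - (z - y) * x.
      by rewrite mulrBr mulrBl hz // opprB [RHS]addrC subrKA.
    apply: le_trans (cnormB _ _) _; rewrite addrC; apply: lerD.
      apply: le_trans (cnormM _ _) _.
      by rewrite ler_wpM2l ?cnorm_ge0 // lerDl ler01.
    apply: le_trans (cnormM _ _) _.
    by rewrite ler_wpM2r ?cnorm_ge0 // lerDl ler01.
  by move: zy; rewrite !ltr_pdivlMr // => h1 h2; exfalso; lra.
Qed.

(** Commutants of self-adjoint sets are C*-subalgebras, so commutation extends from cylinders to the
    diagonal, one factor at a time. *)
Lemma diagC x y : D x -> D y -> x * y = y * x.
Proof.
move=> Dx Dy; apply: (_ : D `<=` [set x | forall y, D y -> x * y = y * x]) => // {x y Dx Dy}.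
apply: diag_sub; first by apply: comm_subalgebra => x; exact: diag_star.
move=> a n y Dy; apply/esym; move: y Dy.
suff H : D `<=` [set y | forall x, (exists b m, x = cyl b m) -> y * x = x * y].
  by move=> y /H; apply; exists a, n.
apply: diag_sub; first by apply: comm_subalgebra => _ [b [m ->]]; exists b, m; rewrite star_cyl.
by move=> b m _ [c [k ->]]; rewrite cylC.
Qed.

End Diagonal.

(** * Approximation by finite combinations of cylinders and of affine isometries *)

Section Approximation.
Variables (R : realType) (A : cstarAlgType R) (U S : A).
Hypothesis hQ : Q2_relations U S.

Local Notation aff := (aff U S).
Local Notation cyl := (cyl U S).
Local Notation D := (diag2 U S).

Definition cylinders : set A := [set x | exists a n, x = cyl a n].

Lemma diag_cspan : D `<=` cclosure (cspan cylinders).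
Proof.
apply: (diag_sub hQ) => [|a n]; last first.
  by apply: cclosure_sub; apply: cspan_sub; exists a, n.
apply: cspan_subalgebra => [_ _ [a [n ->]] [b [m ->]]|_ [a [n ->]]]; last first.
  by exists a, n; rewrite star_cyl.
wlog nm : a b n m / (n <= m)%N.
  by move=> H; case/orP: (leq_total n m) => /H; [exact|rewrite cylC].
have [h|h] := boolP (2 ^+ n %| b - a)%Z.
  by rewrite cylM_dvd //; apply: cspan_sub; exists b, m.
by rewrite cylM_ndvd //; exact: cspan0.
Qed.

Lemma diag_level x t : D x -> 0 < t -> exists M, forall m b, (M <= m)%N ->
  exists c, cnorm (x * cyl b m - c *: cyl b m) <= t.
Proof.
move=> /diag_cspan hx /hx[y [hy yx]] {hx}.
suff [M hM] : exists M, forall m b, (M <= m)%N -> exists c, y * cyl b m = c *: cyl b m.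
  exists M => m b /hM -/(_ b)[c hc]; exists c; rewrite -hc -mulrBl.
  apply: le_trans (cnormM_proj _ (cyl_proj hQ b m)) _.
  by rewrite cnormBC ltW.
elim/cspan_ind: hy => [|c y' z [a [n ->]] [M hM]].
  by exists 0%N => m b _; exists 0; rewrite mul0r scale0r.
exists (maxn M n) => m b; rewrite geq_max => /andP[/hM -/(_ b)[c' hc'] nm].
have [h|h] := boolP (2 ^+ n %| b - a)%Z.
  by exists (c + c'); rewrite mulrDl hc' -scalerAl cylM_dvd // scalerDl.
by exists c'; rewrite mulrDl hc' -scalerAl cylM_ndvd // scaler0 add0r.
Qed.

(* If neither [q p] nor [p - q p] vanishes, a scalar [c] with [q p] close to [c p]
   would be close to both 1 and 0. *)
Lemma diag_proj q : D q -> projection q -> exists M, forall m b, (M <= m)%N ->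
  q * cyl b m = 0 \/ q * cyl b m = cyl b m.
Proof.
move=> Dq [sq qq]; have t0 : 0 < 4^-1 :> R by rewrite invr_gt0.
have [M hM] := diag_level Dq t0; exists M => m b /hM -/(_ b)[c hc].
set p := cyl b m in hc *; have [sp pp] : projection p := cyl_proj hQ b m.
have qp : q * p = p * q by apply: (diagC hQ) => //; exact: diag_cyl.
have prj : projection (q * p).
  by split; rewrite ?starM ?sp ?sq // -mulrA (mulrA p) -qp -mulrA pp mulrA qq.
have [|nz] := eqVneq (q * p) 0; first by left.
right; apply/eqP; rewrite eq_sym -subr_eq0; apply: contraT => nz'.
have prj' : projection (p - q * p).
  split; first by rewrite starB sp (proj1 prj).
  by rewrite mulrBl !mulrBr pp (proj2 prj) mulrA -qp -mulrA pp subrr subr0.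
have h1 : 1 - nc c <= 4^-1.
  apply: le_trans (ncB1 c) _.
  have -> : nc (1 - c) = cnorm ((1 - c) *: (q * p)) by rewrite cnormZr (cnorm_proj prj nz) mulr1.
  have -> : (1 - c) *: (q * p) = (q * p - c *: p) * (q * p).
    rewrite mulrBl (proj2 prj) -scalerAl mulrA -qp -mulrA pp.
    by rewrite scalerBl scale1r.
  exact: le_trans (cnormM_proj _ prj) hc.
have h2 : nc c <= 4^-1.
  have -> : nc c = cnorm (- (c *: (p - q * p))).
    by rewrite cnormN cnormZr (cnorm_proj prj' nz') mulr1.
  have -> : - (c *: (p - q * p)) = (q * p - c *: p) * (p - q * p).
    rewrite mulrBl mulrBr (proj2 prj) -mulrA pp subrr sub0r -scalerAl.
    by rewrite mulrBr pp (mulrA p) -qp -mulrA pp.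
  exact: le_trans (cnormM_proj _ prj') hc.
exfalso; clear -h1 h2; lra.
Qed.

Lemma diag_proj_cyl q : D q -> projection q -> q != 0 ->
  exists b m, q * cyl b m = cyl b m.
Proof.
move=> Dq pq nz; have [M hM] := diag_proj Dq pq.
apply: contrapT => hno; move/eqP: nz; apply.
rewrite -[q]mulr1 -(cyl_sum hQ M) mulr_sumr big1 // => i _.
case: (hM M i%:Z (leqnn _)) => // h.
by case: hno; exists i%:Z, M.
Qed.

(** The map [x |-> e * x * f] is contractive, so the values on cylinders determine where it sends
    the closed span. *)
Lemma diag_mulmap e f x : cnorm e <= 1 -> cnorm f <= 1 ->
  (forall a n, D (e * cyl a n * f)) -> D x -> D (e * x * f).
Proof.
move=> e1 f1 hc /diag_cspan hx; apply: diag_closed => t /hx[y [hy yx]].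
exists (e * y * f); split; last first.
  rewrite -mulrBl -mulrBr; apply: le_lt_trans yx.
  apply: le_trans (cnormM _ _) _; apply: le_trans (_ : cnorm (e * (y - x)) <= _).
    by rewrite ler_piMr ?cnorm_ge0.
  by apply: le_trans (cnormM _ _) _; rewrite ler_piMl ?cnorm_ge0.
elim/cspan_ind: hy => [|c y' z [a [n ->]] IH].
  by rewrite mulr0 mul0r; exact: diag0.
by rewrite mulrDr mulrDl -scalerAr -scalerAl; apply: diag_scaleD.
Qed.

Lemma diag_aff_conj a n x : D x -> D (aff a n * x * star (aff a n)).
Proof.
apply: diag_mulmap; rewrite ?cnorm_star ?cnorm_aff // => b m.
by rewrite (aff_cyl_aff hQ); exact: diag_cyl.
Qed.

Lemma diag_aff_conj' a n x : D x -> D (star (aff a n) * x * aff a n).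
Proof.
apply: diag_mulmap; rewrite ?cnorm_star ?cnorm_aff // => b m.
have -> : star (aff a n) * cyl b m * aff a n =
    (star (aff a n) * aff b m) * star (star (aff a n) * aff b m).
  by rewrite starM starK cylE !mulrA.
case: (star_aff_aff hQ a n b m) => [->|[c [k ->]]|[c [k ->]]].
- by rewrite mul0r; exact: diag0.
- by rewrite -cylE; exact: diag_cyl.
- by rewrite starK (aff_isom hQ); exact: diag1.
Qed.

Definition lin (s : seq (R[i] * (int * nat))) : A :=
  \sum_(i <- s) i.1 *: aff i.2.1 i.2.2.

(** The coefficients of each key are added up. Distinct keys are needed to separate the maps on a
    subcylinder in [normalizer_affine]. *)
Lemma lin_uniq s : exists s', uniq (map snd s') /\ lin s' = lin s.
Proof.
pose ks := undup (map snd s).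
exists [seq (\sum_(i <- s | i.2 == k) i.1, k) | k <- ks]; split.
  by rewrite -map_comp map_id_in ?undup_uniq.
rewrite /lin big_map /=.
under eq_bigr do rewrite scaler_suml.
rewrite (exchange_big_dep xpredT) //= big_seq [RHS]big_seq; apply: eq_bigr => i si.
rewrite (big_rem i.2) /=; last by rewrite mem_undup map_f.
rewrite eqxx big_seq_cond big1 ?addr0 // => k /andP[+ /eqP ik].
by rewrite -ik mem_rem_uniqF ?undup_uniq.
Qed.

Definition monomials : set A := [set x | exists a n b m, x = aff a n * star (aff b m)].

Lemma monomials_dense : cstar_generated [set U; S] = [set: A] ->
  forall x, cclosure (cspan monomials) x.
Proof.
move=> hgen x; have : [set: A] x by [].
rewrite -hgen; apply: cstar_generated_sub => [|y].
  apply: cspan_subalgebra => [_ _ [a [n [b [m ->]]]] [a' [n' [b' [m' ->]]]]|].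
    rewrite -mulrA (mulrA _ _ (star (aff b' m'))).
    case: (star_aff_aff hQ b m a' n') => [->|[c [k ->]]|[c [k ->]]].
    - by rewrite mul0r mulr0; exact: cspan0.
    - by rewrite mulrA affM //; apply: cspan_sub; do 4 eexists.
    - by rewrite -starM affM //; apply: cspan_sub; do 4 eexists.
  by move=> _ [a [n [b [m ->]]]]; exists b, m, a, n; rewrite starM starK.
move=> hy; apply: cclosure_sub; apply: cspan_sub.
case: hy => ->.
  by exists 1, 0%N, 0, 0%N; rewrite aff00 star1 mulr1 affE Upow1 expr0 mulr1.
by exists 0, 1%N, 0, 0%N; rewrite aff00 star1 mulr1 affE Upow0 expr1 mul1r.
Qed.

(** Beyond the levels of all its adjoint factors, a combination of monomials times [aff b m]
    contains no adjoints: each one is absorbed or yields 0. *)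
Lemma lin_level x t : cstar_generated [set U; S] = [set: A] -> 0 < t ->
  exists M, forall m b, (M <= m)%N -> exists s, cnorm (x * aff b m - lin s) <= t.
Proof.
move=> /monomials_dense/(_ x) hx /hx[y [hy yx]] {hx}.
suff [M hM] : exists M, forall m b, (M <= m)%N -> exists s, y * aff b m = lin s.
  exists M => m b /hM -/(_ b)[s hs]; exists s; rewrite -hs -mulrBl.
  apply: le_trans (cnormM_isom _ (aff_isom hQ b m)) _.
  by rewrite cnormBC ltW.
elim/cspan_ind: hy => [|c _ z [a [n [a' [n' ->]]]] [M hM]].
  by exists 0%N => m b _; exists [::]; rewrite mul0r /lin big_nil.
exists (maxn M n') => m b; rewrite geq_max => /andP[/hM -/(_ b)[s hs] nm].
have [h|h] := boolP (2 ^+ n' %| b - a')%Z; rewrite mulrDl hs -scalerAl -mulrA.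
  rewrite aff_dvd // affM //.
  exists ((c, (a + 2 ^+ n * ((b - a') %/ 2 ^+ n')%Z, (n + (m - n'))%N)) :: s).
  by rewrite [in RHS]/lin big_cons.
by exists s; rewrite aff_ndvd // mulr0 scaler0 add0r.
Qed.

End Approximation.

(** * Uniqueness of the decomposition *)

(** From |x| < 2^|x|: the absolute value serves as a crude bound on the 2-adic valuation. *)
Lemma ndvd_pow2 (x : int) m : x != 0 -> (`|x| <= m)%N -> ~~ (2 ^+ m %| x)%Z.
Proof.
move=> x0 xm; apply/negP; rewrite dvdzE abszX => /dvdn_leq.
by rewrite absz_gt0 x0 leqNgt => /(_ isT)/negP[]; apply: leq_ltn_trans xm (ltn_expl _ _).
Qed.

Lemma ndvd_pow2_seq (s : seq int) : exists M, forall x m, x \in s -> x != 0 ->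
  (M <= m)%N -> ~~ (2 ^+ m %| x)%Z.
Proof.
elim: s => [|y s [M hM]]; first by exists 0%N.
exists (maxn `|y| M) => x m; rewrite inE geq_max => /orP[/eqP->|xs] x0 /andP[ym Mm].
  exact: ndvd_pow2.
exact: hM.
Qed.

Section Uniqueness.
Variables (R : realType) (A : cstarAlgType R) (U S : A).
Hypothesis hQ : Q2_relations U S.

Local Notation u := (Upow U).
Local Notation aff := (aff U S).
Local Notation cyl := (cyl U S).
Local Notation D := (diag2 U S).

(** The form [word_partition_sum] with words and powers of [U] merged into affine isometries;
    [affine_word] and [word_affine] show the equivalence. *)
Definition affine_sum (P : A) : Prop :=
  exists (N : nat) (a b : 'I_N -> int) (n m : 'I_N -> nat),
    [/\ P = \sum_(i < N) aff (a i) (n i) * star (aff (b i) (m i)),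
        \sum_(i < N) cyl (a i) (n i) = 1 & \sum_(i < N) cyl (b i) (m i) = 1].

Lemma affine_word P : affine_sum P -> word_partition_sum U S P.
Proof.
move=> [N [a [b [n [m [-> an bm]]]]]].
have /choice[f hf] : forall x : int * nat, exists y : seq bool * int,
    aff x.1 x.2 = Sword U S y.1 * u y.2.
  by move=> [x k]; have [s [l h]] := aff_Sword hQ k x; exists (s, l).
have hc x k : Sword U S (f (x, k)).1 * star (Sword U S (f (x, k)).1) = cyl x k.
  rewrite cylE (hf (x, k)) /= starM mulrA -(mulrA _ (u _)).
  by have [_ ->] := Upow_unit hQ (f (x, k)).2; rewrite mulr1.
exists N, (fun i => (f (a i, n i)).1), (fun i => (f (b i, m i)).1),
  (fun i => (f (a i, n i)).2 - (f (b i, m i)).2); split.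
- apply: eq_bigr => i _; rewrite (hf (a i, n i)) (hf (b i, m i)) /= starM.
  by rewrite (UpowD hQ) (UpowN hQ) !mulrA.
- by under eq_bigr do rewrite hc.
- by under eq_bigr do rewrite hc.
Qed.

Lemma word_affine P : word_partition_sum U S P -> affine_sum P.
Proof.
move=> [N [a [b [k [-> an bm]]]]].
have /choice[f hf] := Sword_aff hQ.
exists N, (fun i => f (a i) + 2 ^+ size (a i) * k i), (fun i => f (b i)),
  (fun i => size (a i)), (fun i => size (b i)); split.
- apply: eq_bigr => i _; rewrite -hf; congr (_ * _).
  by rewrite -[X in aff _ X]addn0 -(affM hQ) -hf affE expr0 mulr1.
- rewrite -an; apply: eq_bigr => i _; rewrite hf -cylE; apply: cyl_dvdE => //.
  by rewrite addrC addKr dvdz_mulr.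
- by rewrite -bm; apply: eq_bigr => i _; rewrite [in RHS]hf -cylE.
Qed.

Lemma affine_star P : affine_sum P -> affine_sum (star P).
Proof.
move=> [N [a [b [n [m [-> an bm]]]]]]; exists N, b, a, m, n; split => //.
by rewrite star_sum; apply: eq_bigr => i _; rewrite starM starK.
Qed.

(** Multiplying the partition [bm] by [aff x l] shows that exactly one of its cylinders contains
    that of [x], so a single summand of [P] survives. *)
Lemma affine_level P : affine_sum P -> exists M, forall m b, (M <= m)%N ->
  exists c k, P * aff b m = aff c k.
Proof.
move=> [N [a [b [n [m [-> _ bm]]]]]]; exists (\max_i m i) => l x lM.
have ml i : (m i <= l)%N by apply: leq_trans lM; exact: leq_bigmax.
pose I := [pred i | (2 ^+ m i %| x - b i)%Z].
have /(congr1 (fun z => z * aff x l)) := bm.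
have c1 : \sum_(i < N) cyl (b i) (m i) * aff x l = #|I|%:R *: aff x l.
  rewrite scaler_nat -sumr_const [RHS]big_mkcond /=; apply: eq_bigr => i _.
  rewrite inE; case: ifP => [h|/negbT h]; first by rewrite cyl_affM_dvd.
  by rewrite cyl_affM_ndvd.
rewrite mulr_suml c1 mul1r => /eqP; rewrite -subr_eq0 -[X in _ - X]scale1r -scalerBl.
rewrite scaler_eq0 (negPf (aff_neq0 hQ _ _)) orbF subr_eq0 (eqr_nat _ _ 1) => /eqP.
move=> /mem_card1[i hi]; exists (a i + 2 ^+ n i * ((x - b i) %/ 2 ^+ m i)%Z), (n i + (l - m i))%N.
rewrite mulr_suml (bigD1 i) //= big1 ?addr0 => [|j ji].
  have := hi i; rewrite !inE eqxx => hii.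
  by rewrite -mulrA aff_dvd // affM.
have := hi j; rewrite !inE (negPf ji) => /negbT hj.
by rewrite -mulrA aff_ndvd // mulr0.
Qed.

Lemma cyl_inj a n b m : cyl a n = cyl b m -> n = m /\ (2 ^+ n %| b - a)%Z.
Proof.
wlog nm : a b n m / (n <= m)%N.
  move=> H h; case/orP: (leq_total n m) => [/H|/H/(_ (esym h))[-> h2]]; first exact.
  by split=> //; rewrite -opprB rpredN.
move=> h; have := cyl_aff hQ a n; rewrite h => h1.
have [ab|ab] := boolP (2 ^+ n %| b - a)%Z; last first.
  have := cyl_neq0 hQ b m; rewrite -(cyl_idem hQ) -{1}h.
  by rewrite (cylM_ndvd hQ) ?eqxx.
split=> //; apply/eqP; rewrite eqn_leq nm /= leqNgt; apply/negP => lt_nm.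
(* If [n < m], the point [b + 2 ^+ n] lies in the first cylinder but not in the second. *)
have := cyl_affM_ndvd hQ (a := b) (n := m) (b := b + 2 ^+ n) (leqnn m).
rewrite -h; have -> : cyl a n = cyl (b + 2 ^+ n) n.
  apply: cyl_dvdE => //; have -> : a - (b + 2 ^+ n) = - (b - a) - 2 ^+ n by lia.
  by rewrite rpredB ?rpredN ?dvdzz.
rewrite -{2}(subnKC nm) (aff_extend hQ) mulrA (cyl_aff hQ) -(aff_extend hQ) subnKC //.
rewrite addrAC subrr add0r.
move=> H; have := aff_neq0 hQ (b + 2 ^+ n) m; rewrite H ?eqxx //.
apply/negP; rewrite dvdzE !abszX => /dvdn_leq; rewrite expn_gt0 => /(_ isT).
by rewrite leq_exp2l // leqNgt lt_nm.
Qed.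

(* Conjugation by [Q] fixes each cylinder [cyl b (M + j)] and also maps it to
   [cyl c (k + j)]; letting [j] grow gives [b = c]. *)
Lemma diag_affine_eq1 Q M : D Q -> unitary Q ->
  (forall b, exists c k, Q * aff b M = aff c k) -> Q = 1.
Proof.
move=> DQ [Q1 Q2] h.
rewrite -[Q]mulr1 -(cyl_sum hQ M) mulr_sumr; apply: eq_bigr => i _.
rewrite cylE mulrA; congr (_ * _).
have [c [k hc]] := h i; rewrite hc.
have H j : (k + j = M + j)%N /\ (2 ^+ (k + j) %| i%:Z - c)%Z.
  apply: cyl_inj; rewrite !cylE.
  have hj : Q * aff i%:Z (M + j) = aff c (k + j).
    by rewrite !(aff_extend hQ) mulrA hc.
  rewrite -hj starM -mulrA (mulrA _ _ (star Q)) -cylE.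
  by rewrite -(diagC hQ (x := star Q)) ?mulrA ?Q2 ?mul1r //; [exact: diag_star|exact: diag_cyl].
have [+ _] := H 0%N; rewrite !addn0 => ->.
congr (aff _ _); apply/eqP; rewrite eq_sym -subr_eq0; apply: contraT => nz.
have [_] := H `|i%:Z - c|%N.
by rewrite (negPf (ndvd_pow2 nz _)) // leq_addl.
Qed.

Lemma diag_affine_unique d P d' P' : D d -> D d' -> unitary d -> unitary d' ->
  unitary P -> unitary P' -> affine_sum P -> affine_sum P' ->
  d * P = d' * P' -> d = d' /\ P = P'.
Proof.
move=> Dd Dd' [d1 d2] [d1' d2'] [P1 P2] [P1' P2'] aP aP' e.
pose Q := P' * star P.
have QE : Q = star d' * d.
  rewrite /Q -[LHS]mul1r -d1' -mulrA (mulrA d') -e -mulrA P2 mulr1 //.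
have Q1 : Q = 1.
  have [M hM] := affine_level aP'; have [M' hM'] := affine_level (affine_star aP).
  (* At level [M'] the factor [star P] acts by an affine map; the [M] further levels survive it and
     make the image deep enough for [P']. *)
  apply: (@diag_affine_eq1 _ (M' + M)).
  - by rewrite QE; apply: diagM => //; exact: diag_star.
  - split; rewrite /Q !starM !starK.
      by rewrite mulrA -(mulrA P) P1' mulr1.
    by rewrite mulrA -(mulrA P') P1 mulr1.
  move=> b; have [c [k h]] := hM' M' b (leqnn _).
  have [c' [k' h']] := hM (k + M)%N c (leq_addl _ _).
  exists c', k'; rewrite -h' /Q -mulrA; congr (_ * _).
  by rewrite !(aff_extend hQ) mulrA h.
split.
  by rewrite -[d]mul1r -d2' -mulrA -QE Q1 mulr1.
by rewrite -[P']mulr1 -P1 mulrA -/Q Q1 mul1r.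
Qed.

End Uniqueness.

(** * The diagonal is maximal abelian *)

Section ShiftAverage.
Variables (R : realType) (A : cstarAlgType R).
Variables (g V : A).
Hypotheses (hg : isometry g) (hV : isometry V).
Hypothesis gV : forall k, star V * g ^+ k.+1 * V = 0.

(* Averaging [V] over the powers of [g] gives an isometry that almost commutes
   with [g] and whose range is contained in the sum of the ranges of [g ^+ k * V]. *)
Definition shift_avg (N : nat) : A :=
  (N%:R^-1 : R[i]) *: \sum_(k < N ^ 2) g ^+ k * V * g ^+ (N ^ 2 - k).

Lemma star_shiftX k l x : star (g ^+ k) * (g ^+ (k + l) * x) = g ^+ l * x.
Proof. by rewrite exprD mulrA mulrA (isometryX k hg) mul1r. Qed.

Lemma shift_orth (k l : nat) : k != l -> star (g ^+ k * V) * (g ^+ l * V) = 0.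
Proof.
wlog kl : k l / (k < l)%N.
  move=> H ne; case: (ltngtP k l) => [h|h|e]; [exact: H| |by rewrite e eqxx in ne].
  by apply: starI; rewrite star0 starM starK H // eq_sym.
move=> _; rewrite starM -mulrA -(subnKC kl) addSnnS star_shiftX.
by rewrite mulrA gV.
Qed.

Lemma shift_isom k : isometry (g ^+ k * V).
Proof. by apply: isometryM => //; exact: isometryX. Qed.

(** The cross terms vanish by [shift_orth], and each of the [N ^ 2] diagonal terms is 1, which the
    squared factor [N^-1] normalizes. *)
Lemma shift_avg_isom N : (0 < N)%N -> isometry (shift_avg N).
Proof.
move=> N0; rewrite /isometry /shift_avg starZ -scalerAl -scalerAr scalerA.
rewrite star_sum mulr_suml (eq_bigr (fun=> 1)) => [|k _]; last first.
  rewrite mulr_sumr (bigD1 k) //= big1 => [|l lk].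
    rewrite addr0 starM mulrA -(mulrA _ _ (g ^+ k * V)) shift_isom mulr1.
    exact: isometryX.
  by rewrite starM mulrA -(mulrA _ _ (g ^+ l * V)) shift_orth 1?eq_sym // mulr0 mul0r.
rewrite sumr_const card_ord -(scaler_nat (N ^ 2) (1 : A)) scalerA fmorphV rmorph_nat natrX -invfM.
by rewrite expr2 mulVf ?scale1r // mulf_neq0 // pnatr_eq0 -lt0n.
Qed.

(** The commutator telescopes to a difference of two isometries, divided by [N]. *)
Lemma shift_avg_comm N : (0 < N)%N ->
  cnorm (shift_avg N * g - g * shift_avg N) <= 2 / N%:R.
Proof.
move=> N0; rewrite /shift_avg -scalerAl -scalerAr -scalerBr cnormZr ncV nc_nat.
rewrite mulrC ler_wpM2r ?invr_ge0 ?ler0n //.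
pose f k := g ^+ k * V * g ^+ ((N ^ 2).+1 - k).
have -> : (\sum_(k < N ^ 2) g ^+ k * V * g ^+ (N ^ 2 - k)) * g -
   g * (\sum_(k < N ^ 2) g ^+ k * V * g ^+ (N ^ 2 - k)) = - (f (N ^ 2)%N - f 0%N).
  rewrite -telescope_sumr // big_mkord mulr_suml mulr_sumr -sumrB -sumrN.
  apply: eq_bigr => k _; rewrite opprB /f; congr (_ - _).
    by rewrite -mulrA -exprSr subSn // ltnW.
  by rewrite subSS exprS !mulrA.
have f1 k : cnorm (f k) = 1.
  by rewrite cnorm_isom // /f; do ?apply: isometryM => //; exact: isometryX.
by rewrite cnormN; apply: le_trans (cnormB _ _) _; rewrite !f1 -natr1.
Qed.

Lemma shift_avg_commX N k : (0 < N)%N ->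
  cnorm (shift_avg N * g ^+ k - g ^+ k * shift_avg N) <= k%:R * (2 / N%:R).
Proof.
move=> N0; elim: k => [|k IH].
  by rewrite expr0 mulr1 mul1r subrr cnorm0 mul0r.
set T := shift_avg N in IH *.
have -> : T * g ^+ k.+1 - g ^+ k.+1 * T = (T * g ^+ k - g ^+ k * T) * g + g ^+ k * (T * g - g * T).
  by rewrite mulrBl mulrBr exprSr !mulrA subrKA.
have -> : k.+1%:R = k%:R + 1 :> R by rewrite natr1.
rewrite (mulrDl k%:R) mul1r; apply: le_trans (cnormD _ _) _; apply: lerD.
  exact: le_trans (cnormM_isom _ hg) IH.
by rewrite cnorm_isomM; [exact: shift_avg_comm|exact: isometryX].
Qed.

Lemma shift_avg_poly (s : seq (R[i] * nat)) (t : R) : 0 < t -> exists N, (0 < N)%N /\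
  cnorm (shift_avg N * (\sum_(i <- s) i.1 *: g ^+ i.2) -
         (\sum_(i <- s) i.1 *: g ^+ i.2) * shift_avg N) <= t.
Proof.
move=> t0; pose C := \sum_(i <- s) nc i.1 * (i.2%:R * 2) : R.
have C0 : 0 <= C by apply: sumr_ge0 => i _; rewrite mulr_ge0 ?nc_ge0 // mulr_ge0 ?ler0n.
have CN := archi_boundP (divr_ge0 C0 (ltW t0)); set N := Num.bound _ in CN.
have N0 : (0 < N)%N.
  by rewrite -(ltr_nat R); apply: le_lt_trans CN; rewrite divr_ge0 // ltW.
exists N; split=> //; rewrite mulr_sumr mulr_suml -sumrB.
apply: le_trans (cnorm_sum _ _ _) _; apply: le_trans (_ : C / N%:R <= _).
  rewrite /C mulr_suml; apply: ler_sum => i _.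
  set T := shift_avg N; rewrite -(scalerAr i.1 T) -(scalerAl i.1 _ T) -scalerBr cnormZr -!mulrA.
  by rewrite ler_wpM2l ?nc_ge0 // shift_avg_commX.
rewrite ler_pdivrMr ?ltr0n // mulrC -ler_pdivrMr //.
exact: ltW.
Qed.

(* [T] denotes the averaged isometry and [Y] the polynomial in [g]: the norm of
   [Y e] is that of [T Y e], nearly that of [Y T e], and on the range of [T] the
   factor [Y] may be replaced by [Z g ^ E], which is small there. *)
Lemma shift_localized (e Z : A) (E : nat) (s : seq (R[i] * nat)) (t : R) : 0 < t ->
  isometry e -> e * star e * V = V -> e * star e * (g * e) = g * e ->
  cnorm (Z * (g ^+ E * e) - (\sum_(i <- s) i.1 *: g ^+ i.2) * e) <= t ->
  (forall k, let x := g ^+ (E + k) * V in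
    Z * (x * star x) = x * star x * Z /\ cnorm (Z * (x * star x)) <= t) ->
  cnorm (Z * (g ^+ E * e)) <= 4 * t.
Proof.
move=> t0 he eV eg; set Y := \sum_(i <- s) _ => hY hZ.
have [N [N0]] := shift_avg_poly s t0; rewrite -/Y; set T := shift_avg N => TY.
have hT : isometry T := shift_avg_isom N0.
have egV k : e * star e * (g ^+ k * V) = g ^+ k * V.
  elim: k => [|k IH]; first by rewrite expr0 mul1r.
  by rewrite exprS -(mulrA g) -IH !mulrA -(mulrA _ g e) eg.
have eT : e * star e * T = T.
  rewrite /T /shift_avg -scalerAr mulr_sumr; congr (_ *: _).
  by apply: eq_bigr => k _; rewrite mulrA egV.
pose x (k : 'I_(N ^ 2)) := g ^+ (E + k) * V.
have hx k : isometry (x k) := shift_isom _.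
have xx k l : k != l -> star (x k) * x l = 0 by move=> kl; apply: shift_orth; rewrite eqn_add2l.
have ZQ : cnorm (Z * \sum_k x k * star (x k)) <= t.
  apply: cnorm_block => // [k|k l kl|k|k].
  - exact: projection_isom.
  - by rewrite mulrA -(mulrA (x k)) xx // mulr0 mul0r.
  - by case: (hZ k).
  - by case: (hZ k).
have QGT : (\sum_k x k * star (x k)) * (g ^+ E * T) = g ^+ E * T.
  rewrite /T /shift_avg -!scalerAr; congr (_ *: _); rewrite !mulr_sumr.
  apply: eq_bigr => k _; rewrite (mulrA (g ^+ E)) (mulrA (g ^+ E)) -exprD -/(x k) mulrA.
  congr (_ * _).
  rewrite mulr_suml (bigD1 k) //= big1 ?addr0 => [|l lk].
    by rewrite -mulrA hx mulr1.
  by rewrite -mulrA xx // mulr0.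
have ZGT : cnorm (Z * (g ^+ E * T)) <= t.
  rewrite -QGT mulrA; apply: le_trans (cnormM_isom _ _) ZQ.
  by apply: isometryM hT; exact: isometryX.
(* The bound 4 t arises as follows: one [t] from [ZGT], one from [hY], one from commuting [T] with
   [Y], and one from [hY] again in the return from [Y * e]. *)
have YT : cnorm (Y * T) <= 2 * t.
  apply: le_trans (cnorm_le_dist _ (Z * (g ^+ E * T))) _.
  rewrite mulr2n mulrDl !mul1r; apply: lerD => //.
  rewrite cnormBC (_ : _ - _ = (Z * (g ^+ E * e) - Y * e) * star e * T).
    by apply: le_trans (cnormM_isom _ hT) _; rewrite cnormM_starisom.
  by rewrite !mulrBl -!mulrA !(mulrA e) eT.
have Yn : cnorm (Y * e) <= 3 * t.
  rewrite -(cnorm_isomM (Y * e) hT) mulrA.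
  apply: le_trans (cnormM_isom _ he) _.
  apply: le_trans (cnorm_le_dist _ (Y * T)) _; lra.
apply: le_trans (cnorm_le_dist _ (Y * e)) _; lra.
Qed.

End ShiftAverage.

(** * Arithmetic of affine maps with a common fixed point *)

Lemma pow2_gauss k M (x : int) : (0 < k)%N ->
  (2 ^+ M %| (2 ^+ k - 1) * x)%Z = (2 ^+ M %| x)%Z.
Proof.
move=> k0; apply: Gauss_dvdzr; apply: coprimezXl.
(* The Bezout relation 2^(k-1) 2 - (2^k - 1) = 1. *)
apply/coprimezP; exists (2 ^+ k.-1, -1).
by case: k k0 => // k _; rewrite exprS /=; ring.
Qed.

Lemma pow2B1_neq0 k : (0 < k)%N -> 2 ^+ k - 1 != 0 :> int.
Proof. by move=> k0; rewrite -pow2Z subr_eq0 eqz_nat -(expn0 2) eqn_exp2l // -lt0n. Qed.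

(* Every affine map [x |-> 2 ^ n * x + a] with the same fixed point as
   [x |-> 2 ^ n1 * x + a1] has slope a power of [2 ^ nu]; here
   [x |-> 2 ^ nu * x + r] has this fixed point too. *)
Lemma fixpoint_generator (a1 : int) (n1 : nat) : (0 < n1)%N ->
  exists (nu : nat) (r : int), [/\ (0 < nu)%N, (2 ^+ n1 - 1) * r = (2 ^+ nu - 1) * a1 &
    forall (a : int) (n : nat), (2 ^+ n1 - 1) * a = (2 ^+ n - 1) * a1 -> (nu %| n)%N].
Proof.
(* The fixed point is -a1 / (2^n1 - 1); [P l] says that an affine map of slope 2^l with integer
   translation has it too. The least such [l] is taken as [nu]. *)
move=> n0; pose P l := (0 < l)%N && (2 ^+ n1 - 1 %| (2 ^+ l - 1) * a1)%Z.
have exP : exists l, P l by exists n1; rewrite /P n0 dvdz_mulr.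
case: (ex_minnP exP) => nu /andP[nu0 /dvdzP[r hr]] hmin.
exists nu, r; split=> // [|a n h]; first by rewrite mulrC.
rewrite /dvdn; apply: contraT; rewrite -lt0n => m0.
(* As in Euclidean division, the remainder would again satisfy [P], against the minimality of
   [nu]. *)
suff /hmin : P (n %% nu)%N by rewrite leqNgt ltn_mod nu0.
rewrite /P m0 /=.
have hn : 2 ^+ n = (2 ^+ nu) ^+ (n %/ nu) * 2 ^+ (n %% nu) :> int.
  by rewrite -exprM -exprD mulnC -divn_eq.
have -> : (2 ^+ (n %% nu) - 1) * a1 =
   (2 ^+ n - 1) * a1 - 2 ^+ (n %% nu) * (((2 ^+ nu) ^+ (n %/ nu) - 1) * a1) by rewrite hn; ring.
rewrite -h; apply: rpredB; first exact: dvdz_mulr (dvdzz _).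
apply: dvdz_mull; rewrite subrX1 mulrAC hr -mulrA.
by apply: dvdz_mull; exact: dvdz_mulr (dvdzz _).
Qed.

(** The translation part of the [i]-th power of [aff r nu], which is the image of 0. *)
Definition aff_pow (r : int) (nu i : nat) : int := iter i (fun x => r + 2 ^+ nu * x) 0.

Section AffPow.
Variables (r : int) (nu : nat).
Hypothesis nu0 : (0 < nu)%N.
Local Notation b := (aff_pow r nu).

Lemma aff_powE i : (2 ^+ nu - 1) * b i = (2 ^+ (nu * i) - 1) * r.
Proof.
elim: i => [|i IH]; first by rewrite muln0 expr0 subrr mul0r mulr0.
rewrite /= -/(b i) mulnS exprD; have -> : (2 ^+ nu - 1) * (r + 2 ^+ nu * b i) =
  (2 ^+ nu - 1) * r + 2 ^+ nu * ((2 ^+ nu - 1) * b i) by ring.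
by rewrite IH; ring.
Qed.

Lemma aff_pow_moveE i s : (2 ^+ nu - 1) * (b i + (2 ^+ (nu * i) - 1) * s) =
  (2 ^+ (nu * i) - 1) * (r + (2 ^+ nu - 1) * s).
Proof. by rewrite mulrDr aff_powE; ring. Qed.

(** The displacements of [s] under the generator and under its [i]-th power agree up to odd factors,
    so they have the same 2-adic valuation. *)
Lemma aff_pow_dvd i M s : (0 < i)%N -> (2 ^+ M %| b i + (2 ^+ (nu * i) - 1) * s)%Z =
  (2 ^+ M %| r + (2 ^+ nu - 1) * s)%Z.
Proof.
move=> i0; rewrite -(pow2_gauss M _ nu0) aff_pow_moveE pow2_gauss //.
by rewrite muln_gt0 nu0.
Qed.

Lemma aff_pow_congr i M s : (2 ^+ M %| r + (2 ^+ nu - 1) * s)%Z ->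
  (2 ^+ M %| b i + 2 ^+ (nu * i) * s - s)%Z.
Proof.
have -> : b i + 2 ^+ (nu * i) * s - s = b i + (2 ^+ (nu * i) - 1) * s by ring.
case: i => [|i]; first by rewrite muln0 expr0 subrr mul0r addr0 dvdz0.
by rewrite aff_pow_dvd.
Qed.

(** Along an orbit of the generator, the displacement is multiplied by the slope. *)
Lemma aff_pow_shift i s : r + (2 ^+ nu - 1) * (b i + 2 ^+ (nu * i) * s) =
  2 ^+ (nu * i) * (r + (2 ^+ nu - 1) * s).
Proof. by rewrite mulrDr aff_powE; ring. Qed.

End AffPow.

(** * Norm estimates on single cylinders for an element commuting with them *)

Section Commutant.
Variables (R : realType) (A : cstarAlgType R) (U S : A).
Hypothesis hQ : Q2_relations U S.

Local Notation aff := (aff U S).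
Local Notation cyl := (cyl U S).
Local Notation lin := (lin U S).
Local Notation D := (diag2 U S).

(* The key [(a, n)] stands for the affine map [x |-> 2 ^ n * x + a], and
   [disp k s] is the displacement of [s]: it is divisible by [2 ^ M] iff the image
   of the cylinder of [s] of level [M] meets this cylinder. *)
Definition disp (k : int * nat) (s : int) : int := k.1 + (2 ^+ k.2 - 1) * s.

Lemma disp_congr M k s s' : (2 ^+ M %| s' - s)%Z ->
  (2 ^+ M %| disp k s')%Z = (2 ^+ M %| disp k s)%Z.
Proof.
move=> h; have -> : disp k s' = disp k s + (2 ^+ k.2 - 1) * (s' - s) by rewrite /disp; ring.
by apply: rpredDr; apply: dvdz_mull.
Qed.

Lemma cyl_aff_cyl0 k s M : ~~ (2 ^+ M %| disp k s)%Z ->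
  cyl s M * aff k.1 k.2 * cyl s M = 0.
Proof.
move=> h; rewrite [X in _ * X]cylE mulrA -(mulrA (cyl s M)) affM //.
rewrite cyl_affM_ndvd ?mul0r ?leq_addl //.
by apply: contra h => h; rewrite /disp mulrBl mul1r addrA.
Qed.

Lemma cyl_lin_cyl0 l s M : (forall k, k \in map snd l -> ~~ (2 ^+ M %| disp k s)%Z) ->
  cyl s M * lin l * cyl s M = 0.
Proof.
move=> h; rewrite mulr_sumr mulr_suml big_seq big1 // => i il.
by rewrite -scalerAr -scalerAl cyl_aff_cyl0 ?scaler0 // h // map_f.
Qed.

Section Bound.
Variables (Z : A) (l l' : seq (R[i] * (int * nat))) (t : R).
Hypothesis t0 : 0 < t.
Hypothesis Zc : forall s M, Z * cyl s M = cyl s M * Z.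
Hypothesis ZW : cnorm (Z - (lin l + star (lin l'))) <= t.
Let ks := map snd l ++ map snd l'.

(** As [Z] commutes with the cylinder, [Z * cyl s M] is a compression of [Z]; the same compression
    kills the approximant, since every key moves the cylinder. *)
Lemma good_bound s M : (forall k, k \in ks -> ~~ (2 ^+ M %| disp k s)%Z) ->
  cnorm (Z * cyl s M) <= t.
Proof.
move=> h; have -> : Z * cyl s M = cyl s M * (Z - (lin l + star (lin l'))) * cyl s M.
  rewrite mulrBr mulrBl mulrDr mulrDl -Zc -mulrA cyl_idem // cyl_lin_cyl0; last first.
    by move=> k kl; apply: h; rewrite mem_cat kl.
  rewrite add0r (_ : cyl s M * star (lin l') * cyl s M = 0) ?subr0 //.
  apply: starI; rewrite star0 !starM starK star_cyl // mulrA cyl_lin_cyl0 // => k kl.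
  by apply: h; rewrite mem_cat kl orbT.
apply: le_trans (cnormM_proj _ (cyl_proj hQ _ _)) _.
exact: le_trans (cnorm_projM _ (cyl_proj hQ _ _)) ZW.
Qed.

(* Beyond level [M0], no translation meets a cylinder that it moves, and two maps
   that both meet a cylinder have the same fixed point. *)
Variable M0 : nat.
Hypothesis M0_slope0 : forall k m, k \in ks -> k.2 = 0%N -> (M0 <= m)%N ->
  ~~ (2 ^+ m %| k.1)%Z.
Hypothesis M0_pair : forall k k', k \in ks -> k' \in ks ->
  let x := (2 ^+ k'.2 - 1) * k.1 - (2 ^+ k.2 - 1) * k'.1 in
  x != 0 -> ~~ (2 ^+ M0 %| x)%Z.
Variable E : nat.
Hypothesis slopeE : forall k, k \in ks -> (k.2 <= E)%N.

Lemma bad_bound s k1 : k1 \in ks -> (0 < k1.2)%N ->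
  (2 ^+ (M0 + E * E) %| disp k1 s)%Z -> cnorm (Z * cyl s (M0 + E * E)) <= 4 * t.
Proof.
move=> k1ks n10; set M := (M0 + E * E)%N => hk1.
(* All keys that move [s] by a multiple of [2 ^ M0] are powers of [g], and [cyl s M]
   is the image of [cyl s M1] under [g ^ E]. *)
have [nu [r [nu0 hr hnu]]] := fixpoint_generator k1.1 n10.
have n1nz := pow2B1_neq0 n10; have nunz := pow2B1_neq0 nu0.
pose b := aff_pow r nu; pose rho x := r + (2 ^+ nu - 1) * x.
pose g := aff r nu; have hg : isometry g := aff_isom hQ r nu.
have gX i : g ^+ i = aff (b i) (nu * i).
  elim: i => [|i IH]; first by rewrite muln0 expr0 (aff00 U S).
  by rewrite exprS IH /g affM // mulnS.
have gXaff i x n : g ^+ i * aff x n = aff (b i + 2 ^+ (nu * i) * x) (nu * i + n).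
  by rewrite gX affM.
(* This is why [E * E] levels are added to [M0]: removing the [nu * E] levels of [g ^+ E] still
   leaves at least [M0]. *)
have nuE : (nu * E <= E * E)%N.
  rewrite leq_mul2r; apply/orP; right; apply: leq_trans (slopeE k1ks).
  by apply: dvdn_leq n10 (hnu k1.1 k1.2 _).
pose M1 := (M - nu * E)%N.
have M01 : (M0 <= M1)%N by rewrite /M1 /M -addnBA // leq_addr.
have ME : (nu * E + M1 = M)%N by rewrite subnKC // (leq_trans nuE) ?leq_addl.
have M1M : (M1 <= M)%N by rewrite leq_subr.
have rhoM : (2 ^+ M %| rho s)%Z.
  rewrite -(pow2_gauss M _ n10).
  have -> : (2 ^+ k1.2 - 1) * rho s = (2 ^+ nu - 1) * disp k1 s.
    by rewrite /rho mulrDr hr /disp; ring.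
  exact: dvdz_mull.
have dvdW m m' x : (m <= m')%N -> (2 ^+ m' %| x)%Z -> (2 ^+ m %| x)%Z.
  by move=> mm; apply: dvdz_trans; exact: dvdz_exp2l.
have rho0 : (2 ^+ M0 %| rho s)%Z by apply: dvdW rhoM; exact: leq_addr.
have rel k : k \in ks -> (2 ^+ M0 %| disp k s)%Z ->
    [/\ (0 < k.2 %/ nu)%N, k.2 = (nu * (k.2 %/ nu))%N & k.1 = b (k.2 %/ nu)%N].
  move=> kks hk; have k0 : (0 < k.2)%N.
    rewrite lt0n; apply/eqP => k20; have := M0_slope0 kks k20 (leqnn _).
    by rewrite /disp k20 expr0 subrr mul0r addr0 in hk *; rewrite hk.
  have d0 : (2 ^+ M0 %| (2 ^+ k1.2 - 1) * k.1 - (2 ^+ k.2 - 1) * k1.1)%Z.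
    have -> : (2 ^+ k1.2 - 1) * k.1 - (2 ^+ k.2 - 1) * k1.1 =
      (2 ^+ k1.2 - 1) * disp k s - (2 ^+ k.2 - 1) * disp k1 s by rewrite /disp; ring.
    by apply: rpredB; apply: dvdz_mull => //; apply: dvdW hk1; exact: leq_addr.
  have e : (2 ^+ k1.2 - 1) * k.1 = (2 ^+ k.2 - 1) * k1.1.
    apply/eqP; rewrite -subr_eq0; apply: contraT => nz.
    by have := M0_pair kks k1ks nz; rewrite d0.
  have dv := hnu _ _ e; have kE : k.2 = (nu * (k.2 %/ nu))%N by rewrite mulnC divnK.
  split=> //; first by rewrite divn_gt0 // dvdn_leq.
  apply: (mulfI n1nz); apply: (mulfI nunz).
  rewrite mulrCA [RHS]mulrCA aff_powE -kE mulrCA e mulrCA -hr.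
  by ring.
have relg k : k \in ks -> (2 ^+ M0 %| disp k s)%Z -> aff k.1 k.2 = g ^+ (k.2 %/ nu).
  by move=> kks /(rel _ kks)[_ kE bE]; rewrite gX -bE -kE.
pose e := aff s M1; have he : isometry e := aff_isom hQ s M1.
pose p0 := cyl s M0.
have p0g i : p0 * (g ^+ i * e) = g ^+ i * e.
  rewrite /e gXaff /p0 cyl_affM_dvd //; first by rewrite (leq_trans M01) ?leq_addl.
  exact: aff_pow_congr.
have GE : cyl s M = g ^+ E * e * star (g ^+ E * e).
  by rewrite /e gXaff -cylE ME; apply: cyl_dvdE => //; rewrite -opprB rpredN; exact: aff_pow_congr.
have hGe : isometry (g ^+ E * e) by apply: isometryM => //; exact: isometryX.
rewrite GE mulrA cnormM_starisom //.
(* The displacement [rho] is affine with nonzero slope, so it cannot vanish at both [s] and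
   [s + 2 ^+ M1]. *)
have [u [us uz]] : exists u, (2 ^+ M1 %| u - s)%Z /\ rho u != 0.
  have [z|] := eqVneq (rho s) 0; last by exists s; rewrite subrr dvdz0.
  exists (s + 2 ^+ M1); split; first by rewrite addrAC subrr add0r dvdzz.
  have -> : rho (s + 2 ^+ M1) = rho s + (2 ^+ nu - 1) * 2 ^+ M1 by rewrite /rho; ring.
  by rewrite z add0r mulf_neq0 // expf_neq0.
pose N0 := maxn M1 `|rho u|.
have N0u : ~~ (2 ^+ N0 %| rho u)%Z by apply: ndvd_pow2 => //; exact: leq_maxr.
pose V := aff u N0.
pose rl k := (2 ^+ M0 %| disp k s)%Z.
(* Exponents are shifted by [E], so that the adjoints of powers of [g] also become nonnegative
   powers. *)
pose sq := [seq (i.1, E + i.2.2 %/ nu)%N | i <- l & rl i.2] ++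
           [seq ((i.1)^*, E - i.2.2 %/ nu)%N | i <- l' & rl i.2].
apply: (@shift_localized _ _ g V hg (aff_isom hQ u N0) _ e Z E sq) => //.
- move=> k; rewrite -mulrA gXaff aff_ndvd ?leq_addl //.
  have -> : b k.+1 + 2 ^+ (nu * k.+1) * u - u = b k.+1 + (2 ^+ (nu * k.+1) - 1) * u by ring.
  by rewrite aff_pow_dvd.
- rewrite /V -cylE cyl_affM_dvd //; exact: leq_maxl.
- rewrite -cylE -[g]expr1 /e gXaff cyl_affM_dvd ?leq_addl //.
  by apply: aff_pow_congr => //; apply: dvdW rhoM.
(* Cutting down by [p0] kills the keys that move this cylinder; the remaining ones are powers of
   [g], so the approximant turns into a polynomial in [g]. *)
- have p0rel k : k \in ks -> p0 * aff k.1 k.2 * (g ^+ E * e) =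
      if rl k then g ^+ (E + k.2 %/ nu) * e else 0.
    move=> kks; case: ifP => [h|/negbT h].
      by rewrite relg // -mulrA (mulrA _ _ e) -exprD addnC p0g.
    by rewrite -[g ^+ E * e]p0g mulrA (cyl_aff_cyl0 h) mul0r.
  have p0rel' k : k \in ks -> p0 * star (aff k.1 k.2) * (g ^+ E * e) =
      if rl k then g ^+ (E - k.2 %/ nu) * e else 0.
    move=> kks; case: ifP => [h|/negbT h].
      have kE : (k.2 %/ nu <= E)%N by apply: leq_trans (leq_div _ _) (slopeE kks).
      have -> : g ^+ E * e = g ^+ (k.2 %/ nu) * (g ^+ (E - k.2 %/ nu) * e).
        by rewrite mulrA -exprD subnKC.
      rewrite relg // -mulrA (mulrA (star _)) (isometryX _ hg) mul1r p0g //.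
    have h0 : p0 * star (aff k.1 k.2) * p0 = 0.
      by apply: starI; rewrite star0 !starM starK star_cyl // mulrA cyl_aff_cyl0.
    by rewrite -[g ^+ E * e]p0g mulrA h0 mul0r.
  have -> : (\sum_(i <- sq) i.1 *: g ^+ i.2) * e = p0 * (lin l + star (lin l')) * (g ^+ E * e).
    rewrite /sq big_cat !big_map !big_filter mulrDl mulrDr mulrDl; congr (_ + _).
      rewrite mulr_sumr !mulr_suml big_mkcond /= big_seq [RHS]big_seq; apply: eq_bigr => i il.
      have iks : i.2 \in ks by rewrite mem_cat map_f.
      rewrite -scalerAr -[in RHS]scalerAl p0rel //.
      by case: ifP => _; rewrite ?scaler0 // -scalerAl.
    rewrite star_sum mulr_sumr !mulr_suml big_mkcond /= big_seq [RHS]big_seq.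
    apply: eq_bigr => i il.
    have iks : i.2 \in ks by rewrite mem_cat orbC map_f.
    rewrite starZ -scalerAr -[in RHS]scalerAl p0rel' //.
    by case: ifP => _; rewrite ?scaler0 // -scalerAl.
  rewrite -[in X in cnorm (X - _)](p0g E) mulrA Zc -(mulrA p0) -(mulrA p0) -mulrBr -mulrBl.
  apply: le_trans (cnorm_projM _ (cyl_proj hQ _ _)) _.
  exact: le_trans (cnormM_isom _ hGe) ZW.
move=> k; rewrite /= /V gXaff -cylE; split; first exact: Zc.
(* A key that failed to move this cylinder would be a power of [g]. But the displacement under [g]
   is here [2 ^+ (nu * j) * rho u], which [2 ^+ (nu * j + N0)] does not divide. *)
apply: good_bound => k' k'ks; apply/negP; set j := (E + k)%N => hk.
have hk0 : (2 ^+ M0 %| disp k' s)%Z.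
  have M0N : (M0 <= N0)%N by rewrite (leq_trans M01) // leq_maxl.
  rewrite -(@disp_congr _ _ s (b j + 2 ^+ (nu * j) * u)).
    by apply: dvdW hk; rewrite (leq_trans M0N) // leq_addl.
  have us0 : (2 ^+ M0 %| u - s)%Z by apply: dvdW us.
  rewrite -[_ - s](subrKA u); apply: rpredD => //.
  apply: aff_pow_congr => //.
  have -> : r + (2 ^+ nu - 1) * u = rho s + (2 ^+ nu - 1) * (u - s) by rewrite /rho; ring.
  by apply: rpredD => //; apply: dvdz_mull.
have [i0 kE bE] := rel _ k'ks hk0.
move: hk; rewrite /disp bE; set q := (k'.2 %/ nu)%N in i0 kE *.
rewrite kE aff_pow_dvd // aff_pow_shift // exprD dvdz_mul2l ?expf_neq0 //.
by apply/negP.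
Qed.

End Bound.
End Commutant.

(** * From estimates on cylinders to the maximality of the diagonal *)

Section MaximalAbelian.
Variables (R : realType) (A : cstarAlgType R) (U S : A).
Hypothesis hQ : Q2_relations U S.

Local Notation aff := (aff U S).
Local Notation cyl := (cyl U S).
Local Notation lin := (lin U S).
Local Notation D := (diag2 U S).

(** At one common level every cylinder falls under [good_bound] or [bad_bound], and [cnorm_block]
    assembles them. Keys of slope 1 are nontrivial translations and move all cylinders of that
    level. *)
Lemma commutant_bound (Z : A) (l l' : seq (R[i] * (int * nat))) (t : R) : 0 < t ->
  (forall s M, Z * cyl s M = cyl s M * Z) ->
  cnorm (Z - (lin l + star (lin l'))) <= t ->
  (forall k, k \in map snd l ++ map snd l' -> k != (0, 0%N)) ->
  cnorm Z <= 4 * t.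
Proof.
move=> t0 Zc ZW nz; set ks := _ ++ _ in nz.
pose X (k k' : int * nat) : int := (2 ^+ k'.2 - 1) * k.1 - (2 ^+ k.2 - 1) * k'.1.
have [M0 hM0] := ndvd_pow2_seq ([seq k.1 | k <- ks] ++ [seq X k k' | k <- ks, k' <- ks]).
pose E := (\max_(k <- ks) k.2)%N.
have slope0 k m : k \in ks -> k.2 = 0%N -> (M0 <= m)%N -> ~~ (2 ^+ m %| k.1)%Z.
  move=> kks k2; apply: hM0; first by rewrite mem_cat map_f.
  by have := nz k kks; case: k k2 {kks} => a n /= ->; apply: contra => /eqP ->.
rewrite -[Z]mulr1 -(cyl_sum hQ (M0 + E * E)); apply: cnorm_block => [|i|i j|i|i].
- by rewrite mulr_gt0.
- exact: cyl_proj.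
- exact: cyl_ord_orth.
- exact: Zc.
have [/hasP[k kks /andP[k0 hk]]|/hasPn h] :=
    boolP (has (fun k => (0 < k.2)%N && (2 ^+ (M0 + E * E) %| disp k i%:Z)%Z) ks).
  apply: (bad_bound hQ t0 Zc ZW slope0 _ _ kks k0 hk) => [k1 k2 k1s k2s x nzx|k' k's].
    by apply: hM0 => //; rewrite mem_cat; apply/orP; right; apply: allpairs_f.
  exact: leq_bigmax_seq.
apply: le_trans (good_bound hQ Zc ZW _) _ => [k kks|]; last by rewrite ler_peMl ?(ltW t0) ?ler1n.
have := h k kks; rewrite negb_and -eqn0Ngt => /orP[/eqP k2|//].
by rewrite /disp k2 expr0 subrr mul0r addr0; apply: slope0 => //; exact: leq_addr.
Qed.

Lemma lin_split l : lin l = (\sum_(i <- l | i.2 == (0, 0%N)) i.1) *: 1 +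
  lin [seq i <- l | i.2 != (0, 0%N)].
Proof.
rewrite /lin big_filter (bigID (fun i => i.2 == (0, 0%N))) /= scaler_suml.
by congr (_ + _); apply: eq_bigr => -[c [a n]] /= /eqP[-> ->]; rewrite aff00.
Qed.

(** The scalar collects the coefficients of the identity map; subtracting it leaves only nontrivial
    keys. *)
Lemma commutant_scalar (d : A) l l' (t : R) : 0 < t ->
  (forall s M, d * cyl s M = cyl s M * d) ->
  cnorm (d - (lin l + star (lin l'))) <= t -> exists c, cnorm (d - c *: 1) <= 4 * t.
Proof.
move=> t0 dc; rewrite (lin_split l) (lin_split l').
set c := \sum_(i <- l | _) _; set c' := \sum_(i <- l' | _) _.
set m := [seq i <- l | _]; set m' := [seq i <- l' | _] => h.
exists (c + c'^*); apply: (commutant_bound (l := m) (l' := m') t0) => [s M||k].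
- by rewrite mulrBl mulrBr -scalerAl -scalerAr mul1r mulr1 dc.
- apply: le_trans h; rewrite starD starZ star1 scalerDl.
  by rewrite [in leRHS]addrACA [in leRHS]opprD [in leRHS]addrA.
by rewrite mem_cat => /orP[|]; case/mapP => i; rewrite mem_filter => /andP[nz _] ->.
Qed.

Lemma star_aff_lin a n s : exists l l', star (aff a n) * lin s = lin l + star (lin l').
Proof.
elim: s => [|[c [b m]] s [l [l' IH]]].
  by exists [::], [::]; rewrite /lin !big_nil mulr0 star0 addr0.
rewrite {1}/lin big_cons mulrDr IH -scalerAr /=.
case: (star_aff_aff hQ a n b m) => [->|[x [k ->]]|[x [k ->]]].
- by exists l, l'; rewrite scaler0 add0r.
- by exists ((c, (x, k)) :: l), l'; rewrite /lin big_cons addrA.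
- exists l, ((c^*, (x, k)) :: l').
  by rewrite /lin big_cons starD starZ /= conjCK addrCA.
Qed.

(** The compression of [d] to a deep cylinder is close to a combination of affine isometries and
    adjoints, hence to a scalar. These scalars, one per cylinder, define a nearby element of the
    diagonal. *)
Lemma diag_maximal_abelian (d : A) : cstar_generated [set U; S] = [set: A] ->
  (forall s M, d * cyl s M = cyl s M * d) -> D d.
Proof.
move=> hgen dc; apply: diag_closed; apply: cclosureW => t t0.
have t4 : 0 < t / 4 by rewrite divr_gt0.
have [M hM] := lin_level hQ d hgen t4.
have /choice[c hc] : forall b : int, exists c,
    cnorm (star (aff b M) * d * aff b M - c *: 1) <= t.
  move=> b; have [s hs] := hM M b (leqnn _).
  have [l [l' e]] := star_aff_lin b M s.
  have [||c] := @commutant_scalar (star (aff b M) * d * aff b M) l l' _ t4.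
  - move=> x m; have H := aff_cyl_aff hQ b M x m.
    have -> : star (aff b M) * d * aff b M * cyl x m =
        star (aff b M) * (d * (aff b M * cyl x m * star (aff b M))) * aff b M.
      by rewrite !mulrA -[RHS]mulrA (aff_isom hQ) mulr1.
    by rewrite H dc -H !mulrA (aff_isom hQ) mul1r.
  - rewrite -e -mulrA -mulrBr; apply: le_trans hs.
    exact: cnorm_starisomM (aff_isom hQ b M).
  by rewrite mulrC divfK // => h; exists c.
pose y := \sum_(i < 2 ^ M) c i%:Z *: cyl i%:Z M.
have ycyl (i : 'I_(2 ^ M)) : y * cyl i%:Z M = c i%:Z *: cyl i%:Z M.
  rewrite mulr_suml (bigD1 i) //= big1 ?addr0 => [|j ji].
    by rewrite -scalerAl cyl_idem.
  by rewrite -scalerAl cyl_ord_orth // scaler0.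
have Dy : D y.
  rewrite /y; elim/big_ind: _ => [|a b Da Db|i _]; first exact: diag0.
    exact: diagD.
  by apply: diagZ; exact: diag_cyl.
exists y; split=> //; rewrite cnormBC -[d - y]mulr1 -(cyl_sum hQ M).
apply: cnorm_block => // [i|i j|i|i].
- exact: cyl_proj.
- exact: cyl_ord_orth.
- by rewrite mulrBl mulrBr dc (diagC hQ Dy) //; exact: diag_cyl.
rewrite mulrBl ycyl; apply: le_trans (hc i%:Z).
have -> : d * cyl i%:Z M - c i%:Z *: cyl i%:Z M =
   aff i%:Z M * (star (aff i%:Z M) * d * aff i%:Z M - c i%:Z *: 1) * star (aff i%:Z M).
  rewrite mulrBr mulrBl -scalerAr -scalerAl mulr1 !mulrA -cylE -mulrA; congr (_ - _).
  by rewrite -dc -!mulrA -cylE cyl_idem.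
by rewrite cnormM_starisom ?cnorm_isomM //; exact: aff_isom.
Qed.

End MaximalAbelian.

(** * Normalizers of the diagonal *)

Section Dichotomy.
Variables (R : realType) (A : cstarAlgType R).

(** If the range projection of [y] were neither 0 nor 1, its complement would give |c| <= 1/4,
    whereas |y| = 1 gives |c| >= 3/4. *)
Lemma near_scalar_left (y : A) (c : R[i]) : projection (y * star y) ->
  cnorm (y - c *: 1) <= 4^-1 ->
  y = 0 \/ y * star y = 1.
Proof.
move=> pr yc; set r := y * star y in pr *.
have [/mul_star_eq0|r0] := eqVneq r 0; first by left.
have [/eqP|r1] := eqVneq (1 - r) 0; first by rewrite subr_eq0 => /eqP ->; right.
have prC := projectionC pr; have [sr rr] := pr; have [srC rrC] := prC.
have ry : (1 - r) * y = 0.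
  apply: mul_star_eq0; rewrite starM srC mulrA -(mulrA _ y) -/r.
  by rewrite mulrBl mul1r rr subrr mul0r.
have c4 : nc c <= 4^-1.
  have -> : nc c = cnorm (- (c *: (1 - r))) by rewrite cnormN cnormZr (cnorm_proj prC r1) mulr1.
  have -> : - (c *: (1 - r)) = (1 - r) * (y - c *: 1).
    by rewrite mulrBr ry sub0r -scalerAr mulr1.
  exact: le_trans (cnorm_projM _ prC) yc.
have y1 : cnorm y = 1.
  rewrite -cnorm_star; apply: sqr_eq_cnorm; rewrite ?cnorm_ge0 //.
  by rewrite -cnorm_starM starK -/r cnorm_proj // expr1n.
have := cnorm_le_dist y (c *: 1); rewrite y1 cnormZr cnorm1 mulr1 => h.
by exfalso; clear -h c4 yc; lra.
Qed.

Lemma near_scalar (y : A) (c : R[i]) : projection (y * star y) -> projection (star y * y) ->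
  cnorm (y - c *: 1) <= 4^-1 ->
  y = 0 \/ [/\ y * star y = 1, star y * y = 1 & 3 / 4 <= nc c].
Proof.
move=> p1 p2 yc; have [|y1] := near_scalar_left p1 yc; first by left.
have := @near_scalar_left (star y) (c^*) _ _; rewrite starK => /(_ p2).
rewrite -[c^* *: 1]/(c^* *: 1 : A) -[X in _ - _ *: X](star1 A) -starZ -starB cnorm_star.
move=> /(_ yc)[y0|y2].
  by left; rewrite -[y]starK y0 star0.
right; split=> //.
have n1 : cnorm y = 1 by apply: cnorm_isom; rewrite /Defs.isometry.
have := cnorm_le_dist y (c *: 1); rewrite n1 cnormZr cnorm1 mulr1 => h.
by clear -h yc; lra.
Qed.

(** Each [star (f i) * X] is a partial isometry close to [c i], hence zero or unitary by
    [near_scalar]. A unitary one gives [X] the range of [f i], which is orthogonal to the other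
    ranges. *)
Lemma isometry_dichotomy n (c : 'I_n -> R[i]) (f : 'I_n -> A) (X : A) :
  isometry X -> (forall i, isometry (f i)) ->
  (forall i j, i != j -> star (f i) * f j = 0) ->
  (forall i, X * star X * (f i * star (f i)) = f i * star (f i) * (X * star X)) ->
  cnorm (X - \sum_i c i *: f i) <= 4^-1 ->
  exists i, [/\ 3 / 4 <= nc (c i), X * star X = f i * star (f i) &
    forall j, j != i -> nc (c j) <= 4^-1].
Proof.
move=> hX hf fo XC Xf.
have yc i : cnorm (star (f i) * X - c i *: 1) <= 4^-1.
  apply: le_trans Xf; have -> : star (f i) * X - c i *: 1 = star (f i) * (X - \sum_i c i *: f i).
    rewrite mulrBr mulr_sumr (bigD1 i) //= big1 ?addr0 => [|j ji].
      by rewrite -scalerAr hf.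
    by rewrite -scalerAr fo ?scaler0 // eq_sym.
  exact: cnorm_starisomM.
have pX := projection_isom hX; have [sX XX] := pX.
have p1 i : projection (star (f i) * X * star (star (f i) * X)).
  rewrite starM starK; split; first by rewrite !starM !starK !mulrA.
  have [q qE] : exists q, q = X * star X by exists (X * star X).
  have -> : star (f i) * X * (star X * f i) = star (f i) * q * f i by rewrite qE !mulrA.
  have := XC i; rewrite -qE in XX *; move=> qf.
  have -> : star (f i) * q * f i * (star (f i) * q * f i) =
    star (f i) * (q * (f i * star (f i))) * q * f i by rewrite !mulrA.
  by rewrite qf !mulrA hf mul1r -(mulrA _ q q) XX.
have p2 i : projection (star (star (f i) * X) * (star (f i) * X)).
  rewrite starM starK; split; first by rewrite !starM !starK !mulrA.
  have -> : star X * f i * (star (f i) * X) * (star X * f i * (star (f i) * X)) =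
    star X * (f i * star (f i) * (X * star X)) * (f i * star (f i)) * X by rewrite !mulrA.
  by rewrite -XC !mulrA hX mul1r -(mulrA _ (star (f i)) (f i)) hf mulr1.
case: (pselect (exists i, star (f i) * X != 0)) => [[i yi]|hno]; last first.
  have y0 i : star (f i) * X = 0.
    by apply: contrapT => /eqP h; apply: hno; exists i.
  (* If all these products vanished, multiplying the error by [star X] would give 1, whose norm
     exceeds 1/4. *)
  have : cnorm (1 : A) <= 4^-1; last by rewrite cnorm1; clear; lra.
  have -> : 1 = star X * (X - \sum_i c i *: f i).
    rewrite mulrBr hX mulr_sumr big1 ?subr0 // => i _.
    by rewrite -scalerAr -[f i]starK -starM y0 star0 scaler0.
  exact: le_trans (cnorm_starisomM _ hX) Xf.
have [y0|[y1 y2 ci]] := near_scalar (p1 i) (p2 i) (yc i).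
  by rewrite y0 eqxx in yi.
have XE : X = f i * star (f i) * X.
  apply/eqP; rewrite -subr_eq0; apply/eqP; apply: star_mul_eq0.
  rewrite starB mulrBl !mulrBr hX !starM !starK !mulrA.
  move: y2; rewrite starM starK !mulrA => y2.
  by rewrite y2 subrr -(mulrA _ _ (f i)) hf mulr1 y2 subrr subrr.
exists i; split=> // [|j ji].
  have [y yE] : exists y, y = star (f i) * X by exists (star (f i) * X).
  have {}XE : X = f i * y by rewrite yE mulrA.
  by rewrite -yE in y1; rewrite XE starM mulrA -(mulrA (f i)) y1 mulr1.
have := yc j; have -> : star (f j) * X = 0 by rewrite XE !mulrA fo // !mul0r.
by rewrite sub0r cnormN cnormZr cnorm1 mulr1.
Qed.

End Dichotomy.

(* The maps of keys [k] and [k'] send the cylinder of [b] of level [L] to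
   disjoint cylinders. *)
Definition sep (k k' : int * nat) (b : int) (L : nat) : bool :=
  ~~ (2 ^+ (L + minn k.2 k'.2) %| (k'.1 + 2 ^+ k'.2 * b) - (k.1 + 2 ^+ k.2 * b))%Z.

Lemma sepC k k' b L : sep k k' b L = sep k' k b L.
Proof. by rewrite /sep minnC -[in RHS]opprB rpredN. Qed.

(** Inside the cylinder, the difference of the two images changes only by multiples of the modulus
    in [sep]. *)
Lemma sep_sub k k' b L b' L' : (L <= L')%N -> (2 ^+ L %| b' - b)%Z ->
  sep k k' b L -> sep k k' b' L'.
Proof.
move=> LL bb; apply: contra => h.
have {}h : (2 ^+ (L + minn k.2 k'.2) %|
    (k'.1 + 2 ^+ k'.2 * b') - (k.1 + 2 ^+ k.2 * b'))%Z.
  by apply: dvdz_trans h; apply: dvdz_exp2l; rewrite leq_add2r.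
have -> : (k'.1 + 2 ^+ k'.2 * b) - (k.1 + 2 ^+ k.2 * b) =
  ((k'.1 + 2 ^+ k'.2 * b') - (k.1 + 2 ^+ k.2 * b')) +
  ((b' - b) * 2 ^+ k.2 - (b' - b) * 2 ^+ k'.2) by ring.
apply: rpredD => //; apply: rpredB; rewrite exprD; apply: dvdz_mul => //.
  by apply: dvdz_exp2l; exact: geq_minl.
by apply: dvdz_exp2l; exact: geq_minr.
Qed.

(** Two distinct affine maps differ at [b0] or at [b0 + 2 ^+ L0], and a deep enough cylinder there
    separates them. *)
Lemma sep_exists k k' b0 L0 : k != k' ->
  exists b L, [/\ (L0 <= L)%N, (2 ^+ L0 %| b - b0)%Z & sep k k' b L].
Proof.
move=> kk; pose f b := (k'.1 + 2 ^+ k'.2 * b) - (k.1 + 2 ^+ k.2 * b).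
suff [b [bb fb]] : exists b, (2 ^+ L0 %| b - b0)%Z /\ f b != 0.
  exists b, (maxn L0 `|f b|); split=> //; first exact: leq_maxl.
  by apply: ndvd_pow2 => //; rewrite (leq_trans (leq_maxr L0 _)) ?leq_addr.
have [f0|] := eqVneq (f b0) 0; last by exists b0; rewrite subrr dvdz0.
exists (b0 + 2 ^+ L0); split; first by rewrite addrAC subrr add0r dvdzz.
have -> : f (b0 + 2 ^+ L0) = f b0 + (2 ^+ k'.2 - 2 ^+ k.2) * 2 ^+ L0 by rewrite /f; ring.
rewrite f0 add0r mulf_neq0 ?expf_neq0 // subr_eq0; apply: contra kk.
rewrite -!pow2Z eqz_nat eqn_exp2l // => /eqP e; apply/eqP.
move: f0; rewrite /f; clear f; case: k k' e => [a n] [a' n'] /= <-.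
rewrite opprD addrACA subrr addr0.
by move=> /eqP; rewrite subr_eq0 => /eqP ->.
Qed.

Lemma sep_all (ps : seq ((int * nat) * (int * nat))) b0 L0 :
  (forall p, p \in ps -> p.1 != p.2) ->
  exists b L, [/\ (L0 <= L)%N, (2 ^+ L0 %| b - b0)%Z &
    forall p, p \in ps -> sep p.1 p.2 b L].
Proof.
elim: ps => [|q ps IH] h; first by exists b0, L0; rewrite subrr dvdz0.
have [p pps|b1 [L1 [l1 d1 s1]]] := IH.
  by apply: h; rewrite inE pps orbT.
have [b [L [l d s]]] := sep_exists b1 L1 (h q (mem_head _ _)).
exists b, L; split=> [||p].
- exact: leq_trans l1 l.
- rewrite -(subrKA b1); apply: rpredD => //.
  by apply: dvdz_trans d; exact: dvdz_exp2l.
- by rewrite inE => /orP[/eqP->//|/s1]; exact: sep_sub.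
Qed.

(** * Isometries with the same action on the diagonal *)

Section Normalizer.
Variables (R : realType) (A : cstarAlgType R) (U S : A).
Hypothesis hQ : Q2_relations U S.

Local Notation aff := (aff U S).
Local Notation cyl := (cyl U S).
Local Notation lin := (lin U S).
Local Notation D := (diag2 U S).

Lemma sep_orth k k' b L : sep k k' b L ->
  star (aff k.1 k.2 * aff b L) * (aff k'.1 k'.2 * aff b L) = 0.
Proof.
wlog kk : k k' / (k.2 <= k'.2)%N.
  move=> H; case/orP: (leq_total k.2 k'.2) => h; first exact: H.
  by rewrite sepC => /(H _ _ h) H'; apply: starI; rewrite star0 starM starK.
rewrite /sep (minn_idPl kk) addnC => h; rewrite !affM //.
by apply: aff_ndvd => //; rewrite leq_add2r.
Qed.

(* Let [e] and [f] be the two conjugates of a cylinder.  If [r = e (1 - f)] is not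
   zero, the diagonal projection [x^* r x] contains a cylinder on which [x] and [y]
   have the same action, which contradicts [r f = 0]. *)
Lemma agree_le (x y : A) : isometry x -> isometry y ->
  (forall q, D q -> D (x * q * star x)) -> (forall q, D q -> D (y * q * star y)) ->
  (forall q, D q -> D (star x * q * x)) ->
  (forall b L, exists b' L', [/\ (L <= L')%N, (2 ^+ L %| b' - b)%Z &
     x * cyl b' L' * star x = y * cyl b' L' * star y]) ->
  forall b L, x * cyl b L * star x * (y * cyl b L * star y) = x * cyl b L * star x.
Proof.
move=> hx hy xD yD xD' hd b L.
have [e eE] : exists e, e = x * cyl b L * star x by eexists.
have [f fE] : exists f, f = y * cyl b L * star y by eexists.
rewrite -eE -fE.
have [se ee] : projection e by rewrite eE; exact: projection_conj hx (cyl_proj hQ b L).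
have [sf ff] : projection f by rewrite fE; exact: projection_conj hy (cyl_proj hQ b L).
have De : D e by rewrite eE; apply: xD; exact: diag_cyl.
have Df : D f by rewrite fE; apply: yD; exact: diag_cyl.
have ef : e * f = f * e by exact: (diagC hQ).
have [r rE] : exists r, r = e - e * f by exists (e - e * f).
have Dr : D r by rewrite rE; apply: diagB => //; exact: diagM.
have er : e * r = r by rewrite rE mulrBr mulrA !ee.
have re : r * e = r by rewrite rE mulrBl -mulrA -ef mulrA !ee.
have rf : r * f = 0 by rewrite rE mulrBl -mulrA ff subrr.
have xe : x * star x * e = e by rewrite eE !mulrA -(mulrA x) hx mulr1.
have ex : e * (x * star x) = e by rewrite -se -[in RHS]xe !starM starK mulrA.
have xr : x * star x * r = r by rewrite -er mulrA xe.
have rx : r * (x * star x) = r by rewrite -re -mulrA ex.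
have rr : r * r = r.
  by rewrite {2}rE mulrBr re mulrA re rf subr0.
have sr : star r = r by rewrite rE starB starM se sf ef.
have [g gE] : exists g, g = star x * r * x by eexists.
have Dg : D g by rewrite gE; exact: xD'.
have pg : projection g.
  rewrite gE; split; first by rewrite !starM starK sr mulrA.
  have -> : star x * r * x * (star x * r * x) = star x * (r * (x * star x)) * r * x.
    by rewrite !mulrA.
  by rewrite rx -(mulrA (star x)) rr.
have rg : r = x * g * star x by rewrite gE !mulrA xr -mulrA rx.
suff g0 : g = 0.
  by move: rE; rewrite rg g0 mulr0 mul0r => /esym/eqP; rewrite subr_eq0 => /eqP.
apply/eqP; apply: contraT => gn.
have [b1 [L1 g1]] := diag_proj_cyl hQ Dg pg gn.
have [b' [L' [LL bb xy]]] := hd b1 L1.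
have gc : g * cyl b' L' = cyl b' L' by rewrite -(cylM_dvd hQ LL bb) mulrA g1.
have gp : g * cyl b L = g.
  have xp : x * cyl b L = e * x by rewrite eE -mulrA hx mulr1.
  by rewrite gE -mulrA xp mulrA -(mulrA _ r) re.
have pc : cyl b L * cyl b' L' = cyl b' L'.
  by rewrite -gc mulrA -(diagC hQ Dg) ?gp //; exact: diag_cyl.
have [w wE] : exists w, w = x * cyl b' L' * star x by eexists.
have rw : r * w = w.
  by rewrite wE rg !mulrA -(mulrA _ (star x)) hx mulr1 -(mulrA x g) gc.
have fw : f * w = w.
  by rewrite wE xy fE !mulrA -(mulrA _ (star y)) hy mulr1 -(mulrA y) pc.
have w0 : w = 0 by rewrite -rw -fw mulrA rf mul0r.
have c0 : cyl b' L' = 0.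
  have -> : cyl b' L' = star x * w * x by rewrite wE !mulrA hx mul1r -mulrA hx mulr1.
  by rewrite w0 mulr0 mul0r.
by have := cyl_neq0 hQ b' L'; rewrite c0 eqxx.
Qed.

(** Applying [agree_le] both ways to commuting projections gives e = e f = f on cylinders; the set
    of [q] where the actions agree is a C*-subalgebra. *)
Lemma agree (x y : A) : isometry x -> isometry y ->
  (forall q, D q -> D (x * q * star x)) -> (forall q, D q -> D (y * q * star y)) ->
  (forall q, D q -> D (star x * q * x)) -> (forall q, D q -> D (star y * q * y)) ->
  (forall b L, exists b' L', [/\ (L <= L')%N, (2 ^+ L %| b' - b)%Z &
     x * cyl b' L' * star x = y * cyl b' L' * star y]) ->
  forall q, D q -> x * q * star x = y * q * star y.
Proof.
move=> hx hy xD yD xD' yD' hd q Dq.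
have hc b L : x * cyl b L * star x = y * cyl b L * star y.
  rewrite -(agree_le hx hy xD yD xD' hd) (diagC hQ).
  - apply: agree_le => // b1 L1; have [b' [L' [h1 h2 h3]]] := hd b1 L1.
    by exists b', L'.
  - by apply: xD; exact: diag_cyl.
  - by apply: yD; exact: diag_cyl.
move: q Dq; apply: (diag_sub hQ (B := [set q | x * q * star x = y * q * star y])) => //.
split.
- by rewrite /= !mulr0 !mul0r.
- by move=> c a b /= ha hb; rewrite !mulrDr !mulrDl -!scalerAr -!scalerAl ha hb.
- move=> a b /= ha hb.
  have E z : isometry z -> z * (a * b) * star z = z * a * star z * (z * b * star z).
    by move=> hz; rewrite -!mulrA (mulrA (star z)) hz mul1r.
  by rewrite !E // ha hb.
- by move=> a /= ha; have := congr1 star ha; rewrite !starM !starK !mulrA.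
- apply/norm_closedP => q hq; apply/eqP; rewrite -subr_eq0; apply/eqP.
  apply: cnorm0_eq0; apply/eqP; rewrite eq_le cnorm_ge0 andbT.
  apply/ler_addgt0Pl => t t0; rewrite addr0.
  have [|a [ha aq]] := hq (t / 2); first by rewrite divr_gt0.
  have -> : x * q * star x - y * q * star y =
      x * (q - a) * star x - y * (q - a) * star y.
    by rewrite !mulrBr !mulrBl ha opprB addrA subrK.
  apply: le_trans (cnormB _ _) _.
  rewrite !cnormM_starisom // !cnorm_isomM // cnormBC [leRHS]splitr.
  by apply: lerD; exact: ltW.
Qed.

End Normalizer.

(** * Construction of the decomposition *)

Section Existence.
Variables (R : realType) (A : cstarAlgType R) (U S : A).
Hypothesis hQ : Q2_relations U S.

Local Notation aff := (aff U S).
Local Notation cyl := (cyl U S).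
Local Notation lin := (lin U S).
Local Notation D := (diag2 U S).

Lemma normalizer_affine (x : A) s : isometry x ->
  (forall q, D q -> D (x * q * star x)) -> (forall q, D q -> D (star x * q * x)) ->
  cnorm (x - lin s) <= 4^-1 ->
  exists k : int * nat, forall q, D q ->
    x * q * star x = aff k.1 k.2 * q * star (aff k.1 k.2).
Proof.
move=> hx xD xD'; have [s' [us <-]] := lin_uniq U S s; move: s' us => {}s us xs.
pose c i := (tnth (in_tuple s) i).1; pose key i := (tnth (in_tuple s) i).2.
have keyI i j : i != j -> key i != key j.
  apply: contra => /eqP e; apply/eqP/val_inj/eqP.
  have x0 : R[i] * (int * nat) := (0, (0, 0%N)).
  rewrite -(nth_uniq x0.2 _ _ us) ?size_map ?ltn_ord // !(nth_map x0) ?ltn_ord //.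
  by move: e; rewrite /key !(tnth_nth x0) => ->.
pose ps := [seq (key i, key j) | i <- enum 'I_(size s), j <- enum 'I_(size s)].
pose ps' := [seq p <- ps | p.1 != p.2].
have ps'n p : p \in ps' -> p.1 != p.2 by rewrite mem_filter => /andP[].
have good b L : (forall p, p \in ps' -> sep p.1 p.2 b L) -> exists i,
    [/\ 3 / 4 <= nc (c i),
        x * cyl b L * star x = aff (key i).1 (key i).2 * cyl b L * star (aff (key i).1 (key i).2) &
        forall j, j != i -> nc (c j) <= 4^-1].
  move=> hsep; pose f i := aff (key i).1 (key i).2 * aff b L.
  have XE (y : A) : y * aff b L * star (y * aff b L) = y * cyl b L * star y.
    by rewrite cylE starM !mulrA.
  have [||i j ij|i||i [h1 h2 h3]] := @isometry_dichotomy _ _ _ c f (x * aff b L).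
  - by apply: isometryM => //; exact: aff_isom.
  - by move=> i; apply: isometryM; exact: aff_isom.
  - apply: (sep_orth hQ); apply: (hsep (_, _)); rewrite mem_filter keyI //=.
    by apply: allpairs_f; rewrite mem_enum.
  - rewrite !XE; apply: (diagC hQ); first by apply: xD; exact: diag_cyl.
    by apply: (diag_aff_conj hQ); exact: diag_cyl.
  - apply: le_trans xs; apply: le_trans (cnormM_isom _ (aff_isom hQ b L)).
    rewrite mulrBl /lin mulr_suml [in leRHS]big_tnth.
    by under [in leRHS]eq_bigr do rewrite -scalerAl.
  by exists i; split=> //; rewrite -!XE.
(* One separating cylinder fixes the index [i]; its choice does not affect the result. *)
have [b0 [L0 [_ _ /good[i [ci _ hi]]]]] := sep_all 0 0 ps'n.
exists (key i); apply: (agree hQ hx (aff_isom hQ _ _) xD _ xD').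
- by move=> q; exact: diag_aff_conj.
- by move=> q; exact: diag_aff_conj'.
move=> b L; have [b' [L' [LL bb /good[j [cj xE hj]]]]] := sep_all b L ps'n.
exists b', L'; split=> //; have [-> //|ij] := eqVneq i j.
(* A different index on this cylinder would bound by 1/4 a coefficient that is at least 3/4. *)
by have := hj _ ij; clear -ci => h; exfalso; lra.
Qed.

Lemma normalizer_decomposition (v : A) : cstar_generated [set U; S] = [set: A] ->
  unitary v -> [set v * x * star v | x in D] = D ->
  exists d P, [/\ unitary d, D d, unitary P, affine_sum U S P & v = d * P].
Proof.
move=> hgen [v1 v2] hD.
have vD q : D q -> D (v * q * star v) by move=> Dq; rewrite -hD; exists q.
have vDK q : D q -> D (star v * q * v) /\ q = v * (star v * q * v) * star v.
  rewrite -{1}hD => -[p Dp <-].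
  have -> : star v * (v * p * star v) * v = p by rewrite !mulrA v1 mul1r -mulrA v1 mulr1.
  by split.
have t0 : 0 < 4^-1 :> R by rewrite invr_gt0.
have [M hM] := lin_level hQ v hgen t0.
pose e (b : int) := aff b M.
have he b : isometry (e b) := aff_isom hQ b M.
have /choice[k hk] : forall b : int, exists k : int * nat, forall q, D q ->
    v * e b * q * star (v * e b) = aff k.1 k.2 * q * star (aff k.1 k.2).
  move=> b; have [s hs] := hM M b (leqnn _); apply: normalizer_affine hs.
  - exact: (isometryM v1 (he b)).
  - move=> q Dq; rewrite starM.
    have -> : v * e b * q * (star (e b) * star v) =
        v * (e b * q * star (e b)) * star v by rewrite !mulrA.
    by apply: vD; exact: diag_aff_conj.
  - move=> q Dq; rewrite starM.
    have -> : star (e b) * star v * q * (v * e b) =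
        star (e b) * (star v * q * v) * e b by rewrite !mulrA.
    by apply: (diag_aff_conj' hQ); case: (vDK q Dq).
pose a (b : int) := aff (k b).1 (k b).2.
have ha b : isometry (a b) := aff_isom hQ _ _.
(* The case q = 1 of [hk]: [v] conjugates the ranges of the [e b] into those of the [a b], which are
   therefore again orthogonal with sum 1 over level [M]. *)
have aa b : a b * star (a b) = v * (e b * star (e b)) * star v.
  by have := hk b 1 (diag1 hQ); rewrite !mulr1 starM !mulrA => <-.
have eo (i j : 'I_(2 ^ M)) : i != j -> star (e i%:Z) * e j%:Z = 0.
  move=> ij; have := cyl_ord_orth hQ ij; rewrite !cylE => h.
  have := congr1 (fun z => star (e i%:Z) * z * e j%:Z) h.
  by rewrite mulr0 mul0r !mulrA he mul1r -mulrA he mulr1.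
have ao (i j : 'I_(2 ^ M)) : i != j -> star (a i%:Z) * a j%:Z = 0.
  move=> ij; have h : a i%:Z * star (a i%:Z) * (a j%:Z * star (a j%:Z)) = 0.
    rewrite !aa !mulrA -(mulrA _ (star v)) v1 mulr1 -(mulrA _ (star (e i%:Z))) eo //.
    by rewrite mulr0 !mul0r.
  have := congr1 (fun z => star (a i%:Z) * z * a j%:Z) h.
  by rewrite mulr0 mul0r !mulrA ha mul1r -mulrA ha mulr1.
have se : \sum_(i < 2 ^ M) e i%:Z * star (e i%:Z) = 1.
  by rewrite -(cyl_sum hQ M); apply: eq_bigr => i _; rewrite cylE.
have sa : \sum_(i < 2 ^ M) a i%:Z * star (a i%:Z) = 1.
  under eq_bigr do rewrite aa.
  by rewrite -mulr_suml -mulr_sumr se mulr1.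
have [P PE] : exists P, P = \sum_(i < 2 ^ M) a i%:Z * star (e i%:Z) by eexists.
have Pe (i : 'I_(2 ^ M)) : P * e i%:Z = a i%:Z.
  rewrite PE mulr_suml (bigD1 i) //= big1 ?addr0 => [|j ji].
    by rewrite -mulrA he mulr1.
  by rewrite -mulrA eo // mulr0.
have Pa (i : 'I_(2 ^ M)) : star P * a i%:Z = e i%:Z.
  rewrite PE star_sum mulr_suml (bigD1 i) //= big1 ?addr0 => [|j ji].
    by rewrite starM starK -mulrA ha mulr1.
  by rewrite starM starK -mulrA ao // mulr0.
have P1 : star P * P = 1.
  by rewrite {2}PE mulr_sumr -[RHS]se; apply: eq_bigr => i _; rewrite mulrA Pa.
have P2 : P * star P = 1.
  rewrite {2}PE star_sum mulr_sumr -[RHS]sa; apply: eq_bigr => i _.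
  by rewrite starM starK mulrA Pe.
(* A diagonal element is the sum of its blocks on the cylinders of level [M], and on each block [v]
   acts as the affine map used by [P]. *)
have vP p : D p -> v * p * star v = P * p * star P.
  move=> Dp.
  have pE : p = \sum_(i < 2 ^ M) e i%:Z * (star (e i%:Z) * p * e i%:Z) * star (e i%:Z).
    rewrite -[LHS]mulr1 -se mulr_sumr; apply: eq_bigr => i _.
    rewrite !mulrA -[e _ * star (e _) * p * _ * _]mulrA -cylE -(diagC hQ Dp) //; last exact: diag_cyl.
    by rewrite -[RHS]mulrA cyl_idem // cylE mulrA.
  rewrite pE !mulr_sumr !mulr_suml; apply: eq_bigr => i _.
  have Dq : D (star (e i%:Z) * p * e i%:Z) by exact: diag_aff_conj'.
  have := hk i%:Z _ Dq; rewrite -/(a i%:Z) -Pe; set q := star _ * p * _ => h.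
  transitivity (v * e i%:Z * q * star (v * e i%:Z)); first by rewrite starM !mulrA.
  by rewrite h starM !mulrA.
exists (v * star P), P; split=> //.
- rewrite /Defs.unitary starM starK; split.
    by rewrite mulrA -(mulrA P) v1 mulr1.
  by rewrite mulrA -(mulrA v) P1 mulr1.
(* With the cylinder written as v p v^* = P p P^* for a diagonal [p], its products with [v * star P]
   on either side both equal v p P^*. *)
- apply: (diag_maximal_abelian hQ hgen) => s m.
  have [Dp pE] := vDK _ (diag_cyl hQ s m); set p := star v * _ * v in Dp pE.
  rewrite pE {1}(vP p Dp) !mulrA -(mulrA v (star P) P) P1 mulr1.
  by rewrite -(mulrA _ (star v) v) v1 mulr1.
- exists (2 ^ M)%N, (fun i => (k i%:Z).1), (fun i => i%:Z), (fun i => (k i%:Z).2), (fun=> M).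
  split=> //; last exact: cyl_sum.
  by rewrite -[RHS]sa; apply: eq_bigr => i _; rewrite cylE.
- by rewrite -mulrA P1 mulr1.
Qed.

End Existence.

Theorem theorem4p8 (R : realType) (A : cstarAlgType R) (U S2 : A)
    (hQ2 : is_Q2 U S2) (v : A) (hv : unitary v)
    (hnorm : [set v * x * star v | x in diag2 U S2] = diag2 U S2) :
  exists! dP : A * A,
    [/\ unitary dP.1, diag2 U S2 dP.1,
        unitary dP.2, word_partition_sum U S2 dP.2 &
        v = dP.1 * dP.2].
Proof.
have [hQ hgen _] := hQ2.
have [d [P [ud Dd uP aP vE]]] := normalizer_decomposition hQ hgen hv hnorm.
exists (d, P); split=> [|[d' P'] /= [ud' Dd' uP' wP' vE']].
  by split=> //; exact: affine_word.
have e : d * P = d' * P' by rewrite -vE.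
by have [-> ->] := diag_affine_unique hQ Dd Dd' ud ud' uP uP' aP (word_affine hQ wP') e.
Qed.
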